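(* Let $\mathcal{V}$ be a Euclidean Jordan algebra of rank $n$ with eigenvalue map $\lambda:\mathcal{V}\to\mathbb{R}^n$. Suppose $Q\subseteq\mathbb{R}^n$ is permutation invariant and one of the following conditions holds: (a) $\mathcal{V}$ is simple and $Q^{\downarrow}$ is connected (arcwise connected). (b) $Q$ is connected (arcwise connected). Then $\lambda^{-1}(Q)$ is connected (respectively, arcwise connected) in $\mathcal{V}$.
   Context: A Euclidean Jordan algebra is a finite-dimensional real inner product space $(\mathcal{V},\langle\cdot,\cdot\rangle)$ with a commutative bilinear product $\circ$ having a unit element $e$ and satisfying $x\circ(x^2\circ y)=x^2\circ(x\circ y)$ and $\langle x\circ y,z\rangle=\langle y,x\circ z\rangle$ for all $x,y,z$, where $x^2=x\circ x$; it carries the norm topology. An idempotent is an element $c$ with $c\circ c=c$; it is primitive if it is nonzero and not a sum of two nonzero idempotents. A Jordan frame is a finite set $\{e_1,\dots,e_n\}$ of primitive idempotents with $e_i\circ e_j=0$ for $i\ne j$ and $e_1+\cdots+e_n=e$; all Jordan frames have the same number $n$ of elements, called the rank of $\mathcal{V}$. Every $x\in\mathcal{V}$ has a spectral decomposition $x=q_1e_1+\cdots+q_ne_n$ with $\{e_1,\dots,e_n\}$ a Jordan frame and $q_i\in\mathbb{R}$; the numbers $q_1,\dots,q_n$ (with multiplicity) depend only on $x$ and are called the eigenvalues of $x$. The eigenvalue map $\lambda:\mathcal{V}\to\mathbb{R}^n$ sends $x$ to the vector of its eigenvalues written in decreasing order. $\mathcal{V}$ is simple if it is nonzero and is not a direct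 product of nonzero Euclidean Jordan algebras (equivalently, has no non-trivial ideal). A nonempty set $Q\subseteq\mathbb{R}^n$ is permutation invariant if $\sigma(Q)=Q$ for every $n\times n$ permutation matrix $\sigma$. For $q\in\mathbb{R}^n$, $q^{\downarrow}$ is the decreasing rearrangement of $q$ (entries satisfy $q^\downarrow_1\ge\cdots\ge q^\downarrow_n$), and $Q^{\downarrow}:=\{q^{\downarrow}:q\in Q\}$. A set is arcwise connected (= path connected) if any two of its points can be joined by a continuous path lying in the set. The statement is to be read as two parallel statements, one for ''connected'' and one for ''arcwise connected''. *)

(* Defs.v *)
From HB Require Import structures.
From mathcomp Require Import all_boot all_order all_algebra all_fingroup.
From mathcomp Require Import all_classical all_reals all_analysis.

Set Implicit Arguments.
Unset Strict Implicit.
Unset Printing Implicit Defensive.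

Import Order.TTheory GRing.Theory Num.Theory numFieldNormedType.Exports.

Local Open Scope classical_set_scope.
Local Open Scope ring_scope.

(* Finite dimensionality comes from [Vector]; the topology is that of the
   [NormedModule] norm, which [norm_inner] ties to the inner product. *)
HB.mixin Record isEuclideanJordan (R : realType) V
    of NormedModule R V & Vector R V := {
  jmul : V -> V -> V ;
  jone : V ;
  inner : V -> V -> R ;
  jmul_bilinear : bilinear_for *:%R *:%R jmul ;
  jmulC : commutative jmul ;
  jmul1 : left_id jone jmul ;
  jordan_identity : forall x y,
    jmul x (jmul (jmul x x) y) = jmul (jmul x x) (jmul x y) ;
  inner_bilinear : bilinear_for *%R *%R inner ;
  innerC : commutative inner ;
  inner_gt0 : forall x, x != 0 -> 0 < inner x x ;
  inner_jmul : forall x y z, inner (jmul x y) z = inner y (jmul x z) ;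
  norm_inner : forall x, `|x| = Num.sqrt (inner x x)
}.

#[short(type="euclideanJordanType")]
HB.structure Definition EuclideanJordan (R : realType) :=
  { V of NormedModule R V & Vector R V & isEuclideanJordan R V }.

Section EuclideanJordanTheory.
Variables (R : realType) (V : euclideanJordanType R).

Definition idempotent_elt (c : V) : Prop := jmul c c = c.

Definition primitive_idempotent (c : V) : Prop :=
  [/\ idempotent_elt c, c != 0 &
      ~ exists a b : V, [/\ idempotent_elt a, idempotent_elt b,
                            a != 0, b != 0 & c = a + b]].

(* A frame {e_1, ..., e_n} is given by an enumeration 'I_n -> V, which is
   injective: if c i = c j with i != j then c i = jmul (c i) (c j) = 0. *)
Definition jordan_frame (n : nat) (c : 'I_n -> V) : Prop :=
  [/\ forall i, primitive_idempotent (c i),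
      forall i j, i != j -> jmul (c i) (c j) = 0 &
      \sum_(i < n) c i = jone].

(* All Jordan frames of V have the same number of elements, so at most one
   n satisfies this. *)
Definition has_rank (n : nat) : Prop :=
  exists c : 'I_n -> V, jordan_frame c.

Definition spectral_decomposition (n : nat) (x : V) (q : 'rV[R]_n) : Prop :=
  exists c : 'I_n -> V,
    jordan_frame c /\ x = \sum_(i < n) q ord0 i *: c i.

(* An isomorphism f from the direct product V1 x V2 (componentwise product,
   sum of the inner products) onto V.  The library's norm on V1 * V2 is a max
   norm, so V1 * V2 is not itself used as a Euclidean Jordan algebra. *)
Definition is_direct_product (V1 V2 : euclideanJordanType R) : Prop :=
  exists f : {linear (V1 * V2)%type -> V},
    [/\ bijective f,
        forall p q : V1 * V2,
          f (jmul p.1 q.1, jmul p.2 q.2) = jmul (f p) (f q) &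
        forall p q : V1 * V2,
          inner (f p) (f q) = inner p.1 q.1 + inner p.2 q.2].

Definition simple_jordan : Prop :=
  (exists x : V, x != 0) /\
  ~ exists V1 V2 : euclideanJordanType R,
      [/\ exists x1 : V1, x1 != 0, exists x2 : V2, x2 != 0 &
          is_direct_product V1 V2].

End EuclideanJordanTheory.

Definition decreasing_rearrangement (R : realType) (n : nat) (q : 'rV[R]_n) :
    'rV[R]_n :=
  \row_(i < n) nth 0 (sort >=%R [seq q ord0 j | j : 'I_n]) i.

(* The eigenvalues of x, in decreasing order.  By the spectral theorem a
   decomposition exists when n is the rank of V, and the result does not
   depend on the one chosen; the default 0 is then never used. *)
Definition jordan_eigenvalues (R : realType) (V : euclideanJordanType R) (n : nat)
    (x : V) : 'rV[R]_n :=
  decreasing_rearrangement (xget 0 [set q | spectral_decomposition x q]).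

Definition permutation_invariant (R : realType) (n : nat) (Q : set 'rV[R]_n) :
    Prop :=
  Q !=set0 /\ forall s : 'S_n, [set q *m perm_mx s | q in Q] = Q.

Definition arcwise_connected (R : realType) (T : topologicalType)
    (A : set T) : Prop :=
  forall x y : T, A x -> A y ->
    exists g : R -> T,
      [/\ {within `[0, 1], continuous g}, g 0 = x, g 1 = y &
          forall t : R, t \in `[0, 1] -> A (g t)].

(* Main.v *)
Require Import Defs.
From HB Require Import structures.
From mathcomp Require Import all_boot all_order all_algebra all_fingroup.
From mathcomp Require Import all_classical all_reals all_analysis.
From mathcomp Require Import ring lra.

(* Everything rests on the Peirce decomposition of V with respect to an
   idempotent and on one optimization argument: on a subalgebra W containing x,
   the eigenspace of the largest eigenvalue of [jmul x] is again a subalgebra.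
   Descending along such eigenspaces produces idempotents, which shows that
   V_1(c) = R c for a primitive idempotent c and yields the spectral theorem.

   If c, d are primitive, distinct and not orthogonal, then d lies in a rank-two
   subalgebra spanned by c, a primitive idempotent a orthogonal to c and some w
   with w o w = c + a, and t c + (1 - t) a + sqrt (t (1 - t)) w is a path of
   primitive idempotents from c to d.  By induction on the number of elements,
   two families of orthogonal primitive idempotents with the same sum are joined
   by a path of such families, up to a permutation; in particular they have the
   same size, which also gives the uniqueness of the eigenvalues.  Following the
   rank-two path from t = 1 to t = 0 exchanges two elements of a frame; when V is
   simple these exchanges generate all permutations, since otherwise a partial
   sum p of the frame would satisfy V_{1/2}(p) = 0 and
   V = V_1(p) x V_1(e - p).

   Hence two points of the preimage of Q are joined by moving first the frame,
   with fixed eigenvalues, and then the eigenvalues, with a fixed frame. *)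

Set Implicit Arguments.
Unset Strict Implicit.
Unset Printing Implicit Defensive.

Import Order.TTheory GRing.Theory Num.Theory numFieldNormedType.Exports.

Local Open Scope classical_set_scope.
Local Open Scope ring_scope.

Local Notation "x ** y" := (jmul x y) (at level 40, left associativity).
Local Notation "''<' x , y >" := (inner x y) (at level 0, x, y at level 60).

(** * Bilinear calculus for the product and the inner product *)

Section JordanAlgebra.
Variables (R : realType) (V : euclideanJordanType R).
Implicit Types (x y z u v w c d p : V) (k l : R).

Lemma jmul_linearl u : linear_for *:%R (fun x => x ** u).
Proof. exact: (jmul_bilinear.1 u). Qed.

Lemma inner_linearl u : linear_for *%R (fun x => '<x, u>).
Proof. exact: (inner_bilinear.1 u). Qed.

Lemma jmulDl x y z : (x + y) ** z = x ** z + y ** z.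
Proof. by have := jmul_linearl z 1 x y; rewrite !scale1r. Qed.

Lemma jmul0x x : 0 ** x = 0.
Proof. by have := jmul_linearl x (-1) 0 0; rewrite scaler0 addr0 scaleN1r addNr. Qed.

Lemma jmulZl k x y : (k *: x) ** y = k *: (x ** y).
Proof. by have := jmul_linearl y k x 0; rewrite jmul0x !addr0. Qed.

Lemma jmulDr x y z : z ** (x + y) = z ** x + z ** y.
Proof. by rewrite jmulC jmulDl !(jmulC z). Qed.

Lemma jmulZr k x y : y ** (k *: x) = k *: (y ** x).
Proof. by rewrite jmulC jmulZl (jmulC y). Qed.

Lemma jmulNl x y : (- x) ** y = - (x ** y).
Proof. by rewrite -scaleN1r jmulZl scaleN1r. Qed.

Lemma jmulNr x y : y ** (- x) = - (y ** x).
Proof. by rewrite jmulC jmulNl (jmulC y). Qed.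

Lemma jmulx0 x : x ** 0 = 0.
Proof. by rewrite jmulC jmul0x. Qed.

Lemma jmulx1 x : x ** jone = x.
Proof. by rewrite jmulC jmul1. Qed.

Lemma innerDl x y z : '<x + y, z> = '<x, z> + '<y, z>.
Proof. by have := inner_linearl z 1 x y; rewrite scale1r mul1r. Qed.

Lemma inner0x x : '<0, x> = 0.
Proof.
by have := inner_linearl x (-1) 0 0; rewrite scaler0 addr0 mulN1r addNr.
Qed.

Lemma innerZl k x y : '<k *: x, y> = k * '<x, y>.
Proof. by have := inner_linearl y k x 0; rewrite inner0x !addr0. Qed.

Lemma innerNl x y : '<- x, y> = - '<x, y>.
Proof. by rewrite -scaleN1r innerZl mulN1r. Qed.

Lemma innerDr x y z : '<z, x + y> = '<z, x> + '<z, y>.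
Proof. by rewrite innerC innerDl !(innerC z). Qed.

Lemma innerZr k x y : '<y, k *: x> = k * '<y, x>.
Proof. by rewrite innerC innerZl (innerC y). Qed.

Lemma innerNr x y : '<y, - x> = - '<y, x>.
Proof. by rewrite innerC innerNl (innerC y). Qed.

Lemma innerx0 x : '<x, 0> = 0.
Proof. by rewrite innerC inner0x. Qed.

Lemma inner_ge0 x : 0 <= '<x, x>.
Proof.
have [->|/inner_gt0/ltW//] := eqVneq x 0.
by rewrite inner0x.
Qed.

Lemma inner_eq0 x : ('<x, x> == 0) = (x == 0).
Proof.
have [->|x0] := eqVneq x 0; first by rewrite inner0x eqxx.
by rewrite gt_eqF// inner_gt0.
Qed.

Lemma inner_sym x y z : '<x ** y, z> = '<y, x ** z>.
Proof. exact: inner_jmul. Qed.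

Lemma inner_ext x y : (forall v, '<x, v> = '<y, v>) -> x = y.
Proof.
move=> xy; apply/eqP; rewrite -subr_eq0 -inner_eq0 innerDl innerNl xy.
by rewrite subrr.
Qed.

Definition expandE := (jmulDl, jmulDr, jmulNl, jmulNr, jmulZl, jmulZr, jmul0x,
  jmulx0, innerDl, innerDr, innerNl, innerNr, innerZl, innerZr, inner0x,
  innerx0).

End JordanAlgebra.

(* Identities between vectors are checked after pairing with an arbitrary
   vector, which makes [ring] and [lra] available. *)
Ltac vring := apply: inner_ext => ?; rewrite ?expandE; first [ring | field].
Ltac vlra v := apply: inner_ext => v; lra.
Ltac vect v H := move: (congr1 (fun z => inner z v) H); rewrite ?expandE => {}H.

(** * The linearized Jordan identity *)

Section Peirce.
Variables (R : realType) (V : euclideanJordanType R).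
Implicit Types (x y z u v w c d p : V) (k l : R).

(** The Jordan identity is cubic in x. The difference of its instances at x + z and x - z, less
    twice the one at z, leaves the part linear in z. *)
Lemma jordan_linearized x y z :
  2 *: (x ** ((x ** z) ** y)) + z ** ((x ** x) ** y) =
  2 *: ((x ** z) ** (x ** y)) + (x ** x) ** (z ** y).
Proof.
have A := jordan_identity (x + z) y.
have B := jordan_identity (x - z) y.
have C := jordan_identity z y.
apply: inner_ext => v.
vect v A; vect v B; vect v C; rewrite !(jmulC z x) in A B *.
lra.
Qed.

Lemma idem_linearized c y z : idempotent_elt c ->
  2 *: (c ** ((c ** z) ** y)) + z ** (c ** y) =
  2 *: ((c ** z) ** (c ** y)) + c ** (z ** y).
Proof. by move=> cc; have := jordan_linearized c y z; rewrite cc. Qed.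

(** Case y = c of [idem_linearized]: [jmul c] is annihilated by 2 t^3 - 3 t^2 + t = t (2 t - 1) (t -
    1), so its eigenvalues lie in {0, 1/2, 1}. *)
Lemma peirce_eq c z : idempotent_elt c ->
  2 *: (c ** (c ** (c ** z))) + c ** z = 3 *: (c ** (c ** z)).
Proof.
move=> cc; have H := idem_linearized c z cc.
apply: inner_ext => v; vect v H; rewrite ?expandE.
move: H; rewrite cc !(jmulC (_ ** z) c) (jmulC z c); lra.
Qed.

(** For these eigenvectors the linearized identity reduces to (2 l - 1) c (z y) = (2 l - 1) k (z y),
    hence the exclusion of l = 1/2. *)
Lemma peirce_mul c z y l k : idempotent_elt c -> c ** z = l *: z ->
  l != 2^-1 -> c ** y = k *: y -> c ** (z ** y) = k *: (z ** y).
Proof.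
move=> cc cz l2 cy; have H := idem_linearized y z cc.
apply: inner_ext => v; vect v H; rewrite cz cy in H; rewrite expandE in H *.
have {}l2 : 2 * l - 1 != 0.
  by apply: contra_neq l2 => E; lra.
apply: (mulfI l2); rewrite expandE in H. move: H; rewrite !expandE. lra.
Qed.

Lemma peirce_comm c z y l : idempotent_elt c -> c ** z = l *: z ->
  l != 2^-1 -> c ** (z ** y) = z ** (c ** y).
Proof.
move=> cc cz l2; have H := idem_linearized y z cc.
apply: inner_ext => v; vect v H; rewrite cz in H; move: H; rewrite !expandE => H.
have {}l2 : 2 * l - 1 != 0.
  by apply: contra_neq l2 => E; lra.
apply: (mulfI l2); lra.
Qed.

Lemma eigen_uniq c x k l : c ** x = k *: x -> c ** x = l *: x -> k != l -> x = 0.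
Proof.
move=> -> /eqP; rewrite -subr_eq0 -scalerBl scaler_eq0 subr_eq0.
by move=> /orP[->//|/eqP].
Qed.

End Peirce.

(** * Peirce decomposition *)

Section PeirceRules.
Variables (R : realType) (V : euclideanJordanType R).
Implicit Types (x y z u v w a b c d f p : V) (k l : R).

Lemma peirce1_mul c z y k : idempotent_elt c -> c ** z = z ->
  c ** y = k *: y -> c ** (z ** y) = k *: (z ** y).
Proof.
move=> cc cz; apply: (peirce_mul (l := 1)) => //; first by rewrite scale1r.
by apply/eqP; lra.
Qed.

Lemma peirce0_mul c z y k : idempotent_elt c -> c ** z = 0 ->
  c ** y = k *: y -> c ** (z ** y) = k *: (z ** y).
Proof.
move=> cc cz; apply: (peirce_mul (l := 0)) => //; first by rewrite scale0r.
by apply/eqP; lra.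
Qed.

Lemma peirce11 c z y : idempotent_elt c -> c ** z = z -> c ** y = y ->
  c ** (z ** y) = z ** y.
Proof.
by move=> cc cz cy; rewrite (peirce1_mul (k := 1)) ?scale1r.
Qed.

Lemma peirce00 c z y : idempotent_elt c -> c ** z = 0 -> c ** y = 0 ->
  c ** (z ** y) = 0.
Proof.
by move=> cc cz cy; rewrite (peirce0_mul (k := 0)) ?scale0r.
Qed.

(** The product z y is an eigenvector of [jmul c] for 0 and for 1 at once. *)
Lemma peirce10 c z y : idempotent_elt c -> c ** z = z -> c ** y = 0 ->
  z ** y = 0.
Proof.
move=> cc cz cy; apply: (@eigen_uniq _ _ c _ 0 1).
- by apply: peirce1_mul; rewrite ?scale0r.
- by rewrite (jmulC z); apply: peirce0_mul; rewrite ?scale1r.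
- by rewrite eq_sym oner_eq0.
Qed.

(** Expresses that u u has no component in V_{1/2}(c); this is the linearized identity with both
    free variables equal to c. *)
Lemma peirce_half_sq c u : idempotent_elt c -> c ** u = 2^-1 *: u ->
  c ** (c ** (u ** u)) = c ** (u ** u).
Proof.
move=> cc cu; have H := jordan_linearized u c c.
move: H; rewrite !(jmulC u c) cu cc !(jmulC _ c) ?expandE cu ?expandE => H.
by apply: inner_ext => v; vect v H; lra.
Qed.

Lemma idem_comm c z y : idempotent_elt c -> c ** z = 0 ->
  c ** (z ** y) = z ** (c ** y).
Proof.
move=> cc cz; apply: (@peirce_comm _ _ c z y 0) => //; first by rewrite scale0r.
by apply/eqP; lra.
Qed.

(** The three projections are the Lagrange polynomials 2 t^2 - t, 4 t - 4 t^2 and (1 - t) (1 - 2 t)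
    at the nodes 1, 1/2 and 0, evaluated at [jmul c]. *)
Definition peirce1 c x := 2 *: (c ** (c ** x)) - c ** x.
Definition peirceh c x := 4 *: (c ** x) - 4 *: (c ** (c ** x)).
Definition peirce0 c x := x - 3 *: (c ** x) + 2 *: (c ** (c ** x)).

Lemma peirce_sum c x : x = peirce1 c x + peirceh c x + peirce0 c x.
Proof. rewrite /peirce1 /peirceh /peirce0; vring. Qed.

Lemma mul_peirce1 c x : idempotent_elt c -> c ** peirce1 c x = peirce1 c x.
Proof.
move=> cc; have H := peirce_eq x cc; rewrite /peirce1.
by apply: inner_ext => v; vect v H; lra.
Qed.

Lemma mul_peirceh c x : idempotent_elt c ->
  c ** peirceh c x = 2^-1 *: peirceh c x.
Proof.
move=> cc; have H := peirce_eq x cc; rewrite /peirceh.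
by apply: inner_ext => v; vect v H; lra.
Qed.

Lemma mul_peirce0 c x : idempotent_elt c -> c ** peirce0 c x = 0.
Proof.
move=> cc; have H := peirce_eq x cc; rewrite /peirce0.
by apply: inner_ext => v; vect v H; lra.
Qed.

(** Allows an equation between vectors to be split into its three Peirce components. *)
Lemma peirce_uniq c x1 xh x0 : idempotent_elt c -> c ** x1 = x1 ->
  c ** xh = 2^-1 *: xh -> c ** x0 = 0 -> x1 + xh + x0 = 0 ->
  [/\ x1 = 0, xh = 0 & x0 = 0].
Proof.
move=> cc c1 ch c0 H0.
have H1 : x1 + 2^-1 *: xh = 0.
  by have := congr1 (jmul c) H0; rewrite !expandE c1 ch c0 addr0.
have H2 : x1 + 4^-1 *: xh = 0.
  have := congr1 (jmul c) H1; rewrite !expandE c1 ch scalerA => <-.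
  by congr (_ + _ *: _); lra.
have Eh : xh = 0.
  by apply: inner_ext => v; vect v H1; vect v H2; lra.
rewrite Eh scaler0 addr0 in H1; rewrite H1 Eh !add0r in H0.
by split.
Qed.

Lemma inner_eigen c x y k l : c ** x = k *: x -> c ** y = l *: y -> k != l ->
  '<x, y> = 0.
Proof.
move=> cx cy kl; have := inner_sym c x y; rewrite cx cy innerZl innerZr.
by move/eqP; rewrite -subr_eq0 -mulrBl mulf_eq0 subr_eq0 (negPf kl) => /eqP.
Qed.

(* [<c, d> = <c d, d>] and [c ** _] is positive semidefinite. *)
Lemma idem_ortho c d : idempotent_elt c -> idempotent_elt d ->
  '<c, d> = 0 -> c ** d = 0.
Proof.
move=> cc dd; rewrite -{1}dd innerC inner_sym innerC (jmulC d) => H.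
have c1 := mul_peirce1 d cc; have ch := mul_peirceh d cc.
have c0 := mul_peirce0 d cc.
have o1h : '<peirce1 c d, peirceh c d> = 0.
  apply: (@inner_eigen c _ _ 1 2^-1); rewrite ?scale1r//.
  by apply/eqP; lra.
have o10 : '<peirce1 c d, peirce0 c d> = 0.
  by apply: (@inner_eigen c _ _ 1 0); rewrite ?scale1r ?scale0r// oner_eq0.
have oh0 : '<peirceh c d, peirce0 c d> = 0.
  apply: (@inner_eigen c _ _ 2^-1 0); rewrite ?scale0r//.
move: (peirce_sum c d) c1 ch c0 o1h o10 oh0 H.
move: (peirce1 c d) (peirceh c d) (peirce0 c d) => x1 xh x0 -> c1 ch c0 o1h o10 oh0.
rewrite !expandE c1 ch c0 !expandE !(innerC xh x1) o1h o10 oh0.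
have := inner_ge0 x1; have := inner_ge0 xh => p1 ph H.
have : x1 == 0 by rewrite -inner_eq0; apply/eqP; lra.
have : xh == 0 by rewrite -inner_eq0; apply/eqP; lra.
by move=> /eqP-> /eqP->; rewrite scaler0 !addr0.
Qed.

Lemma idem_add a b : idempotent_elt a -> idempotent_elt b -> a ** b = 0 ->
  idempotent_elt (a + b).
Proof.
rewrite /idempotent_elt => aa bb ab.
by rewrite !expandE (jmulC b) aa bb ab addr0 add0r.
Qed.

Lemma idem_add_ortho a b : idempotent_elt a -> idempotent_elt b ->
  idempotent_elt (a + b) -> a ** b = 0.
Proof.
rewrite /idempotent_elt !expandE (jmulC b) => -> -> H.
by apply: inner_ext => v; vect v H; lra.
Qed.

Lemma idem_sub p a : idempotent_elt p -> idempotent_elt a -> p ** a = a ->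
  idempotent_elt (p - a).
Proof.
rewrite /idempotent_elt => pp aa pa.
by rewrite !expandE (jmulC a) aa pp pa; vring.
Qed.

Lemma idem_sub_ortho p a : idempotent_elt a -> p ** a = a -> a ** (p - a) = 0.
Proof. by rewrite /idempotent_elt => aa pa; rewrite !expandE (jmulC a) aa pa subrr. Qed.

Lemma idem_addl a b x : idempotent_elt a -> a ** b = 0 ->
  a ** x = x -> (a + b) ** x = x.
Proof. by move=> aa ab ax; rewrite expandE ax (jmulC b) (peirce10 aa) ?addr0. Qed.

Lemma idem_trans p f x : idempotent_elt f ->
  p ** f = f -> f ** x = x -> p ** x = x.
Proof.
move=> ff pf fx; rewrite -(subrK f p) addrC; apply: idem_addl => //.
exact: idem_sub_ortho.
Qed.

Lemma idem_sub_mul p a x : idempotent_elt p -> idempotent_elt a ->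
  p ** a = a -> (p - a) ** x = x -> a ** x = 0 /\ p ** x = x.
Proof.
move=> pp aa pa pax; have H := idem_sub_ortho aa pa.
have ax : a ** x = 0.
  rewrite jmulC; apply: (@peirce10 (p - a)) => //; first exact: idem_sub.
  by rewrite jmulC.
by split=> //; move: pax; rewrite expandE jmulNl ax subr0.
Qed.

Lemma idem_norm c : idempotent_elt c -> '<c, c> = '<jone, c>.
Proof. by move=> cc; rewrite -{3}cc -inner_sym jmulx1. Qed.

Lemma idem_one : idempotent_elt (jone : V).
Proof. exact: jmul1. Qed.

End PeirceRules.

(** * Idempotents and the spectral theorem *)

Lemma cvg_big_sum (R : realType) (T : topologicalType)
    (W : normedModType R) (I : Type) (r : seq I) (f : I -> T -> W) (t : T) :
  (forall i, f i s @[s --> t] --> f i t) ->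
  \sum_(i <- r) f i s @[s --> t] --> \sum_(i <- r) f i t.
Proof.
move=> fc; elim: r => [|i r IHr].
  by rewrite big_nil; under eq_fun do rewrite big_nil; exact: cvg_cst.
rewrite big_cons; under eq_fun do rewrite big_cons.
by apply: cvgD; [exact: fc | exact: IHr].
Qed.

Lemma within_continuousV (R : realType) (T : topologicalType) (f g : T -> R)
    (A : set T) : continuous f -> continuous g -> (forall t, A t -> g t != 0) ->
  {within A, continuous (fun t => f t / g t)}.
Proof.
move=> fc gc g0; apply: continuous_in_subspaceT => t /set_mem At.
by apply: cvgM; [exact: fc | apply: cvgV; [exact: g0 | exact: gc]].
Qed.

Section Spectral.
Variables (R : realType) (V : euclideanJordanType R).
Implicit Types (x y z u v w a b c d f p : V) (k l : R) (W : {vspace V}).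

Lemma jmul_linear x : linear (jmul x).
Proof. exact: (jmul_bilinear.2 x). Qed.

HB.instance Definition _ x := GRing.isLinear.Build R V V *:%R (jmul x)
  (jmul_linear x).

Definition eigsp x k : {vspace V} := lker (linfun (jmul x) - k *: \1%VF).

Lemma mem_eigsp x k y : (y \in eigsp x k) = (x ** y == k *: y).
Proof.
by rewrite memv_ker add_lfunE opp_lfunE scale_lfunE id_lfunE lfunE subr_eq0.
Qed.

Lemma memv_peirce1 p y : (y \in eigsp p 1) = (p ** y == y).
Proof. by rewrite mem_eigsp scale1r. Qed.

Lemma continuous_quad (T : topologicalType) n (f : 'I_n -> T -> R)
    (B : 'I_n -> 'I_n -> R) : (forall i, continuous (f i)) ->
  continuous (fun t => \sum_i \sum_j f i t * f j t * B i j).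
Proof.
move=> fc t; apply: (@cvg_big_sum R _ R) => i; apply: (@cvg_big_sum R _ R) => j.
by apply: cvgM; [apply: cvgM; exact: fc | exact: cvg_cst].
Qed.

(** The quotient <x y, y> / <y, y> is continuous and invariant under scaling, so it attains its
    maximum k over the nonzero vectors of W on a compact sphere of coordinate vectors. *)
Lemma rayleigh x W : W != 0%VS -> exists k y0, [/\ y0 \in W, y0 != 0,
  '<x ** y0, y0> = k * '<y0, y0> &
  forall y, y \in W -> '<x ** y, y> <= k * '<y, y> ].
Proof.
move=> W0; set n := \dim W; pose b := vbasis W.
pose phi (r : 'rV[R]_n) := \sum_i r ord0 i *: b`_i.
have inner_phi (g : {linear V -> V}) r : '<g (phi r), phi r> =
    \sum_i \sum_j r ord0 i * r ord0 j * '<g (b`_i), (b`_j)>.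
  rewrite /phi linear_sum.
  rewrite (big_morph (fun z => '<z, _>) (fun z1 z2 => innerDl z1 z2 _)
    (inner0x _)).
  apply: eq_bigr => i _.
  rewrite (big_morph (fun z => '<_, z>) (fun z1 z2 => innerDr z1 z2 _)
    (innerx0 _)).
  by apply: eq_bigr => j _; rewrite linearZ /= innerZl innerZr mulrA.
have phiW r : phi r \in W.
  by apply: memv_suml => i _; rewrite memvZ// vbasis_mem// mem_nth// size_tuple.
have phiP y : y \in W -> exists r, y = phi r.
  move=> yW; exists (\row_i coord b i y); rewrite {1}(coord_vbasis yW).
  by apply: eq_bigr => i _; rewrite mxE.
have phi0 r : phi r = 0 -> r = 0.
  move=> /freeP H; apply/rowP => i; rewrite mxE.
  by apply: H; exact: basis_free (vbasisP W).
have phiZ l r : phi (l *: r) = l *: phi r.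
  by rewrite scaler_sumr; apply: eq_bigr => i _; rewrite mxE scalerA.
pose N r := '<phi r, phi r>; pose G r := '<x ** phi r, phi r>.
have Nc : continuous N.
  have -> : N = fun r => \sum_i \sum_j r ord0 i * r ord0 j * '<(b`_i), (b`_j)>.
    by apply/funext => r; rewrite /N (inner_phi idfun).
  by apply: continuous_quad => i; exact: coord_continuous.
have Gc : continuous G.
  have -> : G = fun r => \sum_i \sum_j r ord0 i * r ord0 j * '<x ** (b`_i), (b`_j)>.
    by apply/funext => r; rewrite /G (inner_phi (jmul x)).
  by apply: continuous_quad => i; exact: coord_continuous.
(* This sphere is for the norm of the coordinate space, not that of V; dividing by [N] makes the
   choice harmless. *)
pose S := [set r : 'rV[R]_n | `|r| = 1].
have Sn0 r : S r -> 0 < N r.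
  move=> Sr; apply: inner_gt0; apply/eqP => /phi0 r0.
  by move: Sr; rewrite /S /= r0 normr0 => /eqP; rewrite eq_sym oner_eq0.
have Sne : S !=set0.
  have [y yW y0] : exists2 y, y \in W & y != 0.
    by exists (vpick W); rewrite ?memv_pick ?vpick0.
  have [r yr] := phiP _ yW.
  have r0 : r != 0.
    apply: contraNneq y0 => r0; rewrite yr r0 /phi big1// => i _.
    by rewrite mxE scale0r.
  by exists (`|r|^-1 *: r); rewrite /S /= normrZ normfV normr_id mulVf// normr_eq0.
have Scpt : compact S.
  apply: bounded_closed_compact.
    by exists 1; split=> // M M1 r; rewrite /S /= => ->; exact: ltW.
  have -> : S = (fun r : 'rV[R]_n => `|r|) @^-1` [set 1] by [].
  by apply: closed_comp; [move=> r _; exact: norm_continuous | exact: closed_eq].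
have fc : {within S, continuous (fun r => G r / N r)}.
  by apply: within_continuousV => // r /Sn0; rewrite lt0r => /andP[].
have [r0 /set_mem Sr0 max0] := compact_EVT_max Sne Scpt fc.
have y00 : phi r0 != 0 by rewrite -inner_eq0 gt_eqF// Sn0.
exists (G r0 / N r0), (phi r0); split=> //.
  by rewrite -/(N r0) divfK// gt_eqF// Sn0.
move=> y yW; have [->|y0] := eqVneq y 0; first by rewrite !expandE mulr0.
have [r yr] := phiP _ yW.
have r0' : r != 0.
  apply: contraNneq y0 => r00; rewrite yr r00 /phi big1// => i _.
  by rewrite mxE scale0r.
have Sr : S (`|r|^-1 *: r) by rewrite /S /= normrZ normfV normr_id mulVf// normr_eq0.
have := max0 _ (mem_set Sr); rewrite ler_pdivrMr ?Sn0// /G /N phiZ -yr !expandE.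
by rewrite !(mulrCA _ `|r|^-1) !ler_pM2l// invr_gt0 normr_gt0.
Qed.

End Spectral.

(** * Extremal eigenspaces, idempotents and orthogonal families *)

Section Frames.
Variables (R : realType) (V : euclideanJordanType R).
Implicit Types (x y z u v w a b c d f p : V) (k l : R) (W : {vspace V}).

(* The quadratic form [k <z, z> - <x z, z>] is nonnegative on W and vanishes at
   y, so its first variation at y in the direction [k y - x y] vanishes. *)
Lemma extremal_eigenvector x W k y : {in W, forall z, x ** z \in W} ->
  {in W, forall z, '<x ** z, z> <= k * '<z, z> } -> y \in W ->
  '<x ** y, y> = k * '<y, y> -> x ** y = k *: y.
Proof.
move=> xW Wmax yW yk; have [h hE] : exists h, h = k *: y - x ** y by eexists.
have hW : h \in W by rewrite hE memvB ?memvZ ?xW.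
pose a := '<h, h>; pose b := k * '<h, h> - '<x ** h, h>.
have b0 : 0 <= b by rewrite subr_ge0 Wmax.
have Q t : 0 <= 2 * t * a + t ^+ 2 * b.
  have := Wmax (y + t *: h) (memvD yW (memvZ _ hW)).
  have -> : a = k * '<y, h> - '<x ** y, h>.
    by rewrite /a {1}hE !expandE.
  rewrite /b !expandE yk (inner_sym x h y) (innerC h (x ** y)) (innerC h y).
  lra.
suff a0 : a = 0.
  have : h == 0 by rewrite -inner_eq0 -/a a0.
  by rewrite hE subr_eq0 => /eqP ->.
(* At t = - a s the bound [Q] becomes a^2 s (b s - 2) >= 0 with b s - 2 = - (1 + s) < 0, so a = 0.
   The added 1 covers b = 0. *)
pose s := (b + 1)^-1.
have s0 : 0 < s by rewrite invr_gt0; lra.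
have bs : b * s = 1 - s by rewrite /s; field; apply/eqP; lra.
have H : 0 <= - (a ^+ 2 * (s * (1 + s))).
  have := Q (- (a * s)).
  have -> : 2 * - (a * s) * a + (- (a * s)) ^+ 2 * b =
    a ^+ 2 * s * (b * s - 2) by ring.
  by rewrite bs; congr (0 <= _); ring.
apply/eqP; rewrite -sqrf_eq0 eq_le sqr_ge0 andbT.
by rewrite -(@pmulr_lle0 _ (s * (1 + s))) ?oppr_ge0 // in H *; rewrite mulr_gt0; lra.
Qed.

Definition jclosed W := {in W &, forall x y, x ** y \in W}.

(* From [x y = k y] the linearized Jordan identity gives [x y^3 = k y^3], hence
   [<x y^2, y^2> = <x, y y^3> = k <y^2, y^2>]: y^2 is extremal as well. *)
Lemma eigen_sq x W k : jclosed W -> x \in W ->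
  {in W, forall z, '<x ** z, z> <= k * '<z, z> } ->
  {in (W :&: eigsp x k)%VS, forall y, y ** y \in (W :&: eigsp x k)%VS}.
Proof.
move=> Wc xW Wmax y /memv_capP[yW]; rewrite mem_eigsp => /eqP xy.
rewrite memv_cap mem_eigsp Wc//=; apply/eqP.
apply: (extremal_eigenvector (W := W)) => //; first by move=> z; exact: Wc.
  exact: Wc.
have H : x ** ((y ** y) ** y) = k *: ((y ** y) ** y).
  have H := jordan_linearized y y x; move: H; rewrite (jmulC y x) xy.
  by rewrite !expandE => /addrI ->.
have E : y ** ((y ** y) ** y) = (y ** y) ** (y ** y).
  exact: jordan_identity.
have sq4 : '<y ** y, y ** y> = '<y, (y ** y) ** y>.
  by rewrite inner_sym (jmulC y (y ** y)).
rewrite sq4 (jmulC x) inner_sym -E -inner_sym (jmulC y x) xy !expandE //.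
Qed.

(** Polarization reduces products to the squares treated by [eigen_sq]. *)
Lemma eigen_jclosed x W k : jclosed W -> x \in W ->
  {in W, forall z, '<x ** z, z> <= k * '<z, z> } ->
  jclosed (W :&: eigsp x k).
Proof.
move=> Wc xW Wmax y z yE zE; have sq := eigen_sq Wc xW Wmax.
have -> : y ** z = 2^-1 *: ((y + z) ** (y + z) - y ** y - z ** z).
  by rewrite !expandE (jmulC z y); apply: inner_ext => v; rewrite !expandE; lra.
by rewrite memvZ// !memvB ?sq// memvD.
Qed.

Lemma exists_eigen_subalgebra x W : jclosed W -> x \in W -> W != 0%VS ->
  exists k, jclosed (W :&: eigsp x k) /\ (W :&: eigsp x k)%VS != 0%VS.
Proof.
move=> Wc xW W0; have [k [y [yW y0 yk Wmax]]] := rayleigh x W0.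
exists k; split; first exact: eigen_jclosed.
have yE : y \in (W :&: eigsp x k)%VS.
  rewrite memv_cap yW mem_eigsp; apply/eqP.
  by apply: (extremal_eigenvector (W := W)) => // z; exact: Wc.
by apply: contraNneq y0 => E0; move: yE; rewrite E0 memv0.
Qed.

Lemma sq_eq0 x : x ** x = 0 -> x = 0.
Proof.
move=> xx; apply/eqP; rewrite -inner_eq0 -{2}(jmulx1 x) -inner_sym xx.
by rewrite inner0x.
Qed.

(** Induction on the dimension of W, passing to the extremal eigenspace of some x in W. If that
    eigenspace is all of W, it contains x, so x x = k x; here k != 0 because nonzero elements have
    nonzero squares, and k^-1 x is idempotent. *)
Lemma exists_idempotent W : jclosed W -> W != 0%VS ->
  exists f, [/\ f \in W, idempotent_elt f & f != 0].
Proof.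
have [n] := ubnP (\dim W); elim: n W => // n IHn W; rewrite ltnS => Wn Wc W0.
pose x := vpick W; have x0 : x != 0 by rewrite vpick0.
have xW : x \in W by exact: memv_pick.
have [k [Ec E0]] := exists_eigen_subalgebra Wc xW W0.
have [WE|EW] := eqVneq (W :&: eigsp x k)%VS W; last first.
  have [|f [fE ff f0]] := IHn _ _ Ec E0; last first.
    by exists f; split=> //; move: fE => /memv_capP[].
  apply: leq_trans Wn; rewrite ltn_neqAle dimvS ?capvSl// andbT.
  by apply: contraNneq EW => dE; rewrite -dimv_leqif_eq ?capvSl// dE.
have xx : x ** x = k *: x.
  by apply/eqP; rewrite -mem_eigsp; move: xW; rewrite -WE memv_cap => /andP[].
have k0 : k != 0.
  by apply: contraNneq x0 => k0; rewrite [x]sq_eq0// xx k0 scale0r.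
exists (k^-1 *: x); split; first by rewrite memvZ.
  by rewrite /idempotent_elt !expandE xx scalerK.
by rewrite scaler_eq0 invr_eq0 negb_or k0.
Qed.

Lemma jclosed_peirce1 p : idempotent_elt p -> jclosed (eigsp p 1).
Proof.
move=> pp x y; rewrite !memv_peirce1 => /eqP px /eqP py.
by rewrite peirce11.
Qed.

Lemma exists_eigen_idempotent p x : idempotent_elt p -> p != 0 -> p ** x = x ->
  exists k f, [/\ idempotent_elt f, f != 0, p ** f = f & x ** f = k *: f].
Proof.
move=> pp p0 px; have xW : x \in eigsp p 1 by rewrite memv_peirce1 px.
have W0 : eigsp p 1 != 0%VS.
  by apply: contraNneq p0 => E0; rewrite -memv0 -E0 memv_peirce1 pp.
have [k [Ec E0]] := exists_eigen_subalgebra (jclosed_peirce1 pp) xW W0.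
have [f [/memv_capP[]]] := exists_idempotent Ec E0.
rewrite memv_peirce1 mem_eigsp => /eqP pf /eqP xf ff f0.
by exists k, f.
Qed.

(** An idempotent f in V_1(c) with x f = k f must be c, for otherwise c = f + (c - f) would
    contradict primitivity; hence x = x c = k c. *)
Lemma primitive_peirce1 c x : primitive_idempotent c -> c ** x = x ->
  exists k, x = k *: c.
Proof.
move=> [cc c0 cprim] cx.
have [k [f [ff f0 cf xf]]] := exists_eigen_idempotent cc c0 cx.
exists k; suff fc : f = c by rewrite -{1}cx jmulC -fc.
apply/eqP; apply/negPn/negP => fc; apply: cprim; exists f, (c - f).
split=> //; first exact: idem_sub.
  by rewrite subr_eq0 eq_sym.
by rewrite addrC subrK.
Qed.

(** Gives the decreasing measure for the inductions of [exists_pfam] and [spectral_seq]. *)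
Lemma dim_peirce1_lt a b : idempotent_elt a -> idempotent_elt b -> a ** b = 0 ->
  b != 0 -> (\dim (eigsp a 1) < \dim (eigsp (a + b)%R 1))%N.
Proof.
move=> aa bb ab b0.
have sub : (eigsp a 1 <= eigsp (a + b)%R 1)%VS.
  apply/subvP => x; rewrite !memv_peirce1 => /eqP ax.
  by rewrite idem_addl.
rewrite ltn_neqAle dimvS// andbT; apply: contraNneq b0 => dE.
have : b \in eigsp a 1.
  have /eqP -> : eigsp a 1 == eigsp (a + b)%R 1 by rewrite -dimv_leqif_eq// dE.
  by rewrite memv_peirce1 addrC idem_addl// jmulC.
by rewrite memv_peirce1 ab eq_sym.
Qed.

(** A Jordan frame of the subalgebra V_1(p). A general sum p makes induction possible, and lists
    allow families whose sizes are not yet known to agree. *)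
Definition pfam p (s : seq V) :=
  [/\ {in s, forall c, primitive_idempotent c},
      pairwise (fun x y => x ** y == 0) s & \sum_(c <- s) c = p].

Lemma pfam_cons p c s : pfam p (c :: s) <->
  [/\ primitive_idempotent c, {in s, forall d, c ** d = 0} & pfam (p - c) s].
Proof.
split.
  move=> [sP]; rewrite /= big_cons => /andP[/allP cs ss] <-; split.
  - by apply: sP; rewrite mem_head.
  - by move=> d /cs/eqP.
  - split=> //; last by rewrite addrC addKr.
    by move=> d ds; apply: sP; rewrite in_cons ds orbT.
move=> [cP cs [sP ss sp]]; split.
- by move=> d; rewrite in_cons => /orP[/eqP->//|]; exact: sP.
- by rewrite /= ss andbT; apply/allP => d /cs ->.
- by rewrite big_cons sp addrC subrK.
Qed.

Lemma jmul_sumr x (s : seq V) : x ** (\sum_(c <- s) c) = \sum_(c <- s) x ** c.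
Proof. exact: linear_sum. Qed.

Lemma pfam_idem p s : pfam p s -> idempotent_elt p.
Proof.
elim: s p => [|c s IHs] p; first by move=> [_ _ <-]; rewrite big_nil; exact: jmulx0.
move=> /pfam_cons[[cc _ _] cs ps]; rewrite -(subrK c p) addrC.
apply: idem_add => //; first exact: IHs ps.
by have [_ _ <-] := ps; rewrite jmul_sumr big1_seq// => d /cs.
Qed.

Lemma pfam_mul p s c : pfam p s -> c \in s -> p ** c = c.
Proof.
elim: s p => // c' s IHs p /pfam_cons[[cc c0 _] cs ps].
have c'p : c' ** (p - c') = 0.
  by have [_ _ <-] := ps; rewrite jmul_sumr big1_seq// => d /cs.
rewrite in_cons => /orP[/eqP->|ds].
  by rewrite -[in LHS](subrK c' p) jmulDl cc (jmulC (p - c')) c'p add0r.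
apply: (@idem_trans _ _ _ (p - c')) => //.
- exact: pfam_idem ps.
- by rewrite -{1}(subrK c' p) jmulDl c'p addr0; exact: pfam_idem ps.
- exact: IHs.
Qed.

End Frames.

(** * Spectral decompositions and pairs of primitive idempotents *)

Section RankTwo.
Variables (R : realType) (V : euclideanJordanType R).
Implicit Types (x y z u v w a b c d f g p : V) (k l : R) (W : {vspace V}).

(** For x in s and y in t, first a y = 0 since a lies in V_0(b) and y in V_1(b); then x y = 0 since
    x lies in V_1(a) and y in V_0(a). *)
Lemma pfam_cat a b s t : pfam a s -> pfam b t -> a ** b = 0 ->
  pfam (a + b) (s ++ t).
Proof.
move=> as_ bt ab; have [sP ss sa] := as_; have [tP tt tb] := bt; split.
- by move=> x; rewrite mem_cat => /orP[/sP|/tP].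
- rewrite pairwise_cat ss tt !andbT; apply/allrelP => x y xs yt; apply/eqP.
  apply: (@peirce10 _ _ a) => //; [exact: pfam_idem as_|exact: pfam_mul as_ xs|].
  rewrite jmulC; apply: (@peirce10 _ _ b) => //.
  + exact: pfam_idem bt.
  + exact: pfam_mul bt yt.
  + by rewrite jmulC.
- by rewrite big_cat /= sa tb.
Qed.

Lemma exists_pfam p : idempotent_elt p -> exists s, pfam p s.
Proof.
have [n] := ubnP (\dim (eigsp p 1)); elim: n p => // n IHn p; rewrite ltnS.
move=> pn pp; have [->|p0] := eqVneq p 0.
  by exists [::]; split=> //; rewrite big_nil.
have [pP|] := pselect (primitive_idempotent p).
  exists [:: p]; apply/pfam_cons; split=> //; rewrite subrr; split=> //.
  by rewrite big_nil.
move=> pNP; have : exists a b : V, [/\ idempotent_elt a, idempotent_elt b,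
                            a != 0, b != 0 & p = a + b].
  by apply: contrapT => N; apply: pNP; split.
move=> [a [b [aa bb a0 b0 pE]]].
have ab : a ** b = 0 by apply: idem_add_ortho; rewrite -?pE.
have [||s sa] := IHn a => //.
  by apply: leq_trans pn; rewrite pE dim_peirce1_lt.
have [||t tb] := IHn b => //.
  by apply: leq_trans pn; rewrite pE addrC dim_peirce1_lt// jmulC.
by exists (s ++ t); rewrite pE; exact: pfam_cat.
Qed.

Lemma exists_primitive p : idempotent_elt p -> p != 0 ->
  exists c, primitive_idempotent c /\ p ** c = c.
Proof.
move=> pp p0; have [[|c s] ps] := exists_pfam pp.
  by case: ps => _ _ p00; rewrite -p00 big_nil eqxx in p0.
exists c; split; last by apply: pfam_mul ps _; rewrite mem_head.
by have [sP _ _] := ps; apply: sP; rewrite mem_head.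
Qed.

(** An idempotent f of V_1(p) with x f = k f is split into primitive idempotents, all with
    eigenvalue k; the induction continues with x - k f in V_1(p - f). *)
Lemma spectral_seq p x : idempotent_elt p -> p ** x = x ->
  exists s : seq (R * V), pfam p (map snd s) /\ x = \sum_(e <- s) e.1 *: e.2.
Proof.
have [n] := ubnP (\dim (eigsp p 1)); elim: n p x => // n IHn p x; rewrite ltnS.
move=> pn pp px; have [p0|p0] := eqVneq p 0.
  exists [::]; split; last by rewrite big_nil -px p0 jmul0x.
  by split=> //; rewrite big_nil.
have [k [f [ff f0 pf xf]]] := exists_eigen_idempotent pp p0 px.
have [t ft] := exists_pfam ff.
have fpf := idem_sub_ortho ff pf; have pfi := idem_sub pp ff pf.
have [|||s [sp xE]] := IHn (p - f) (x - k *: f) => //.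
- apply: leq_trans pn; rewrite -{2}(subrK f p) dim_peirce1_lt//.
  by rewrite jmulC.
- by rewrite !expandE px pf ff (jmulC f x) xf; vring.
exists ([seq (k, c) | c <- t] ++ s); split.
  rewrite map_cat -map_comp map_id -(subrK f p) addrC.
  exact: pfam_cat.
rewrite big_cat /= -xE big_map /= -scaler_sumr.
by case: ft => _ _ ->; rewrite addrC subrK.
Qed.

(** Since <f, g> = <g, g>, the square of the norm of f - g vanishes. Primitivity is proved below by
    comparing norms in this way. *)
Lemma idem_le_eq f g : idempotent_elt f -> idempotent_elt g -> f ** g = g ->
  '<g, g> = '<f, f> -> g = f.
Proof.
move=> ff gg fg gf; apply/eqP; rewrite eq_sym -subr_eq0 -inner_eq0.
have H : '<f, g> = '<g, g> by rewrite -{1}gg -inner_sym (jmulC g) fg.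
by rewrite !expandE (innerC g f) H gf; apply/eqP; ring.
Qed.

(* Besides the Peirce components of d o d = d with respect to c, the relations
   come from [peirce1 d c] being a multiple of d. *)
Lemma primitive_pair c d : primitive_idempotent c -> primitive_idempotent d ->
  '<c, d> != 0 -> c != d -> exists l u v,
  [/\ [/\ 0 < l < 1, '<c, c> = '<d, d> & d = l *: c + u + v],
      [/\ c ** u = 2^-1 *: u, c ** v = 0, u != 0 & v != 0],
      u ** v = (2^-1 * (1 - l)) *: u,
      u ** u = (l * (1 - l)) *: c + l *: v &
      v ** v = (1 - l) *: v].
Proof.
move=> cP dP cd0 cd; have [cc c0 _] := cP; have [dd d0 dprim] := dP.
have c1 := mul_peirce1 d cc; have := mul_peirceh d cc.
have := mul_peirce0 d cc; have := peirce_sum c d.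
have [l ->] := primitive_peirce1 cP c1.
move: (peirceh c d) (peirce0 c d) => u v dE cv cu.
have [b bE] : exists b : R, c ** (u ** u) = b *: c.
  by apply: (primitive_peirce1 cP); exact: peirce_half_sq.
have cuv : c ** (v ** u) = 2^-1 *: (v ** u) by exact: peirce0_mul.
have cvv : c ** (v ** v) = 0 by exact: peirce00.
have ccE : c ** c = c by [].
(* b c and s are the components of u u in V_1(c) and V_0(c). *)
have [s sE] : exists s, s = u ** u - b *: c by eexists.
have cs : c ** s = 0 by rewrite sE !expandE bE ccE subrr.
have uu : u ** u = s + b *: c by rewrite sE subrK.
have [E1 Eh E0] : [/\ (l ^+ 2 + b - l) *: c = 0,
    (l - 1) *: u + 2 *: (v ** u) = 0 & s + v ** v - v = 0].
  apply: (peirce_uniq cc).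
  - by rewrite expandE ccE.
  - by rewrite !expandE cu cuv; vring.
  - by rewrite !expandE cs cvv cv !(addr0, subr0).
  have H : d ** d = d by [].
  move: H; rewrite dE !expandE (jmulC u c) (jmulC u v) (jmulC v c) ccE cu cv uu.
  move=> H; apply: inner_ext => z; vect z H; lra.
have {E1} bl : b = l * (1 - l).
  by move/eqP: E1; rewrite scaler_eq0 (negPf c0) orbF => /eqP; lra.
have cuo : '<c, u> = 0.
  apply: (@inner_eigen _ _ c _ _ 1 2^-1) => //; first by rewrite scale1r.
  by apply/eqP; lra.
have cvo : '<c, v> = 0.
  by apply: (@inner_eigen _ _ c _ _ 1 0) => //; rewrite ?scale1r ?scale0r//.
have lE : '<c, d> = l * '<c, c> by rewrite dE !expandE cuo cvo !addr0.
have l0 : l != 0 by apply: contraNneq cd0 => l0; rewrite lE l0 mul0r.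
have cgt0 := inner_gt0 c c0.
have bu : b * '<c, c> = 2^-1 * '<u, u>.
  by rewrite -innerZl -bE inner_sym ccE inner_sym (jmulC u c) cu innerZr.
(* If u = 0 then l = 1 and d = c + v with v idempotent, against c != d or the primitivity of d. *)
have u0 : u != 0.
  apply/eqP => u0; move: bu; rewrite u0 inner0x mulr0 => /eqP.
  rewrite mulf_eq0 (gt_eqF cgt0) orbF bl mulf_eq0 (negPf l0) subr_eq0 => /eqP l1.
  have s0 : s = 0 by rewrite sE u0 jmul0x bl -l1 subrr mulr0 scale0r subrr.
  have {}dE : d = c + v by rewrite dE u0 -l1 scale1r addr0.
  have vv : v ** v = v by rewrite s0 add0r in E0; apply/eqP; rewrite -subr_eq0 E0.
  have [v0|v0] := eqVneq v 0; first by rewrite dE v0 addr0 eqxx in cd.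
  by apply: dprim; exists c, v.
have bgt0 : 0 < b.
  by rewrite -(pmulr_lgt0 _ cgt0) bu mulr_gt0 ?inner_gt0// invr_gt0.
have l01 : 0 < l < 1 by apply/andP; split; rewrite bl in bgt0; nra.
have uv : v ** u = (2^-1 * (1 - l)) *: u.
  by apply: inner_ext => z; vect z Eh; lra.
have [m mE] : exists m : R, peirce1 d c = m *: d.
  by apply: (primitive_peirce1 dP); exact: mul_peirce1.
have [_ Fh F0] : [/\ (2 * l ^+ 2 - l + b - m * l) *: c = 0,
    (l - m) *: u = 0 & s - m *: v = 0].
  apply: (peirce_uniq cc).
  - by rewrite expandE ccE.
  - by rewrite !expandE cu; vring.
  - by rewrite !expandE cs cv scaler0 subr0.
  have dc : d ** c = l *: c + 2^-1 *: u.
    by rewrite dE !expandE (jmulC u) (jmulC v) ccE cu cv addr0.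
  have H := mE; rewrite /peirce1 dc in H.
  have ddc : d ** (l *: c + 2^-1 *: u) = l ^+ 2 *: c + (3 / 4 * l) *: u +
      2^-1 *: (s + b *: c) + (4^-1 * (1 - l)) *: u.
    rewrite dE !expandE (jmulC u c) (jmulC v c) ccE cu cv uu uv.
    by apply: inner_ext => z; rewrite !expandE; field.
  rewrite ddc dE in H; apply: inner_ext => z; vect z H; lra.
have {Fh} ml : m = l.
  by move/eqP: Fh; rewrite scaler_eq0 (negPf u0) orbF subr_eq0 => /eqP.
rewrite ml in mE F0; have {}F0 : s = l *: v by apply/eqP; rewrite -subr_eq0 F0.
have v0 : v != 0.
  apply/eqP => v0; move/eqP: uv; rewrite v0 jmul0x eq_sym scaler_eq0 (negPf u0).
  by rewrite orbF => /eqP; case/andP: l01; lra.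
exists l, u, v; split=> //.
(* The component of c in V_1(d) is l d, so <c, d> = l <d, d>; on the other hand <c, d> = l <c,
   c>. *)
- split=> //; apply: (mulfI l0); rewrite -lE -innerZl -mE /peirce1 !expandE.
  by rewrite !inner_sym !dd; lra.
- by rewrite jmulC.
- by rewrite uu F0 bl addrC.
- by apply: inner_ext => z; rewrite F0 in E0; vect z E0; lra.
Qed.

End RankTwo.

(** * Rotations in rank two *)

Section Rotation.
Variables (R : realType) (V : euclideanJordanType R).
Implicit Types (x y z u v w a b c d f g p : V) (k l t : R).

Lemma primitive_norm c d : primitive_idempotent c -> primitive_idempotent d ->
  '<c, d> != 0 -> '<c, c> = '<d, d>.
Proof.
move=> cP dP cd0; have [->//|cd] := eqVneq c d.
by have [l [u [v [[_ -> _] _ _ _ _]]]] := primitive_pair cP dP cd0 cd.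
Qed.

(** The relations of the symmetric 2 x 2 matrices c = E11, a = E22 and w = E12 + E21. *)
Definition linked c a w :=
  [/\ c ** a = 0, c ** w = 2^-1 *: w, a ** w = 2^-1 *: w & w ** w = c + a].

(** In the matrix model, the orthogonal projection onto the line through (sqrt t, sqrt (1 - t)). *)
Definition jrot c a w t := t *: c + (1 - t) *: a + Num.sqrt (t * (1 - t)) *: w.

Lemma one_half c w : c ** w = 2^-1 *: w -> idempotent_elt c -> '<jone, w> = 0.
Proof.
move=> cw cc; have -> : w = 2 *: (c ** w) by rewrite cw scalerA mulfV ?scale1r.
rewrite innerZr -inner_sym jmulx1 (@inner_eigen _ _ c _ _ 1 2^-1) ?mulr0//.
  by rewrite scale1r.
by apply/eqP; lra.
Qed.

(** Normalizes [primitive_pair]: a = (1 - l)^-1 v and w = (l (1 - l))^(-1/2) u. *)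
Lemma primitive_rank2 c d : primitive_idempotent c -> primitive_idempotent d ->
  '<c, d> != 0 -> c != d -> exists l a w,
  [/\ 0 < l < 1, primitive_idempotent a /\ '<c, c> = '<a, a>, linked c a w,
      d = jrot c a w l &
      forall p, idempotent_elt p -> p ** c = c -> p ** d = d -> p ** a = a].
Proof.
move=> cP dP cd0 cd; have [cc c0 _] := cP; have [dd d0 _] := dP.
have [l [u [v [[l01 cdN dE] [cu cv u0 v0] uv uu vv]]]] := primitive_pair cP dP cd0 cd.
have [lgt0 llt1] := andP l01.
have l1 : 1 - l != 0 by rewrite subr_eq0 gt_eqF.
have l0 : l != 0 by rewrite gt_eqF.
have r0 : 0 < l * (1 - l) by rewrite mulr_gt0// subr_gt0.
pose r := Num.sqrt (l * (1 - l)).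
have rr : r * r = l * (1 - l) by rewrite -expr2 sqr_sqrtr// ltW.
have rn0 : r != 0 by rewrite gt_eqF// sqrtr_gt0.
have [a aE] : exists a, a = (1 - l)^-1 *: v by eexists.
have vE : v = (1 - l) *: a by rewrite aE scalerA mulfV// scale1r.
have aa : a ** a = a by rewrite aE !expandE vv (scalerA _ (1 - l)) mulVf// scale1r.
have ca : c ** a = 0 by rewrite aE expandE cv scaler0.
have au : a ** u = 2^-1 *: u.
  by rewrite aE expandE jmulC uv scalerA mulrCA mulVf// mulr1.
have u1 : '<jone, u> = 0 by exact: one_half cu cc.
(* Pairing d with the unit gives <d, d> = l <c, c> + (1 - l) <a, a>, while <d, d> = <c, c>. *)
have aN : '<a, a> = '<c, c>.
  have : '<d, d> = l * '<c, c> + (1 - l) * '<a, a>.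
    by rewrite (idem_norm dd) dE vE !expandE u1 -!idem_norm// addr0.
  by rewrite -cdN => H; apply: (mulfI l1); lra.
have a0 : a != 0 by rewrite aE scaler_eq0 negb_or invr_eq0 l1.
(* A primitive b below a is orthogonal to c and u but not to d, so it has the norm of d, which is
   that of a; hence b = a. *)
have aP : primitive_idempotent a.
  have [b [bP ab]] := exists_primitive aa a0; have [bb b0 _] := bP.
  have cb : c ** b = 0.
    by rewrite jmulC; apply: (@peirce10 _ _ a) => //; rewrite jmulC.
  have bc0 : '<b, c> = 0 by rewrite -{1}bb inner_sym jmulC cb innerx0.
  have bu0 : '<b, u> = 0.
    apply: (@inner_eigen _ _ c _ _ 0 2^-1); rewrite ?scale0r//.
    by rewrite eq_sym invr_eq0 pnatr_eq0.
  have ba : '<b, a> = '<b, b> by rewrite -{1}bb inner_sym (jmulC b) ab.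
  suff -> : a = b by [].
  apply/esym; apply: idem_le_eq => //; rewrite aN cdN; apply: primitive_norm => //.
  rewrite dE vE !expandE bc0 bu0 mulr0 !add0r ba mulf_neq0//.
  by rewrite inner_eq0.
exists l, a, (r^-1 *: u); split=> //.
- split=> //.
  + by rewrite expandE cu !scalerA mulrC.
  + by rewrite expandE au !scalerA mulrC.
  + rewrite !expandE uu scalerA -invfM rr scalerDr !scalerA mulVf ?gt_eqF//.
    rewrite scale1r vE scalerA (_ : _ * _ = 1) ?scale1r//.
    by field; rewrite l1 l0.
- rewrite /jrot -/r scalerA mulfV// scale1r {1}dE vE.
  by rewrite addrAC.
(* Up to a scalar, a is the expression [peirce0 c d] in c and d, so it stays in the subalgebra
   V_1(p). *)
- move=> p pp pc pd.
  have cp : c ** p = c by rewrite jmulC.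
  have -> : a = (1 - l)^-1 *: peirce0 c d.
    rewrite aE; congr (_ *: _); rewrite /peirce0 dE !expandE cv cu.
    have -> : c ** c = c by [].
    by rewrite !expandE cu (_ : c ** c = c)//; vring.
  rewrite jmulZr /peirce0 !(jmulDr, jmulNr, jmulZr) pd.
  congr (_ *: (_ - _ *: _ + _ *: _)).
    exact: peirce11.
  by apply: peirce11 => //; exact: peirce11.
Qed.

(** Needed for the complement of [jrot c a w t] in c + a, which by [jrot_swap] is a rotated
    idempotent with c and a exchanged and the off-diagonal sign reversed. *)
Lemma linked_swap c a w : linked c a w -> linked a c (- w).
Proof.
by move=> [ca cw aw ww]; split; rewrite ?expandE ?cw ?aw ?scalerN// ?opprK
  ?ww 1?jmulC 1?addrC.
Qed.

Lemma jrot_swap c a w t : c + a - jrot c a w t = jrot a c (- w) t.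
Proof. rewrite /jrot; vring. Qed.

Lemma jrot0 c a w : jrot c a w 0 = a.
Proof. by rewrite /jrot mul0r sqrtr0 !scale0r subr0 scale1r add0r addr0. Qed.

Lemma jrot1 c a w : jrot c a w 1 = c.
Proof. by rewrite /jrot subrr mulr0 sqrtr0 !scale0r scale1r !addr0. Qed.

Lemma linked_unit c a w t : idempotent_elt c -> idempotent_elt a ->
  linked c a w -> (c + a) ** jrot c a w t = jrot c a w t.
Proof.
move=> cc aa [ca cw aw ww]; rewrite /jrot !expandE cw aw (jmulC a c) ca.
rewrite (_ : c ** c = c)// (_ : a ** a = a)//.
by apply: inner_ext => v; rewrite !expandE; field.
Qed.

Lemma jrot_idem c a w t : idempotent_elt c -> idempotent_elt a ->
  linked c a w -> 0 <= t <= 1 -> idempotent_elt (jrot c a w t).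
Proof.
move=> cc aa [ca cw aw ww] /andP[t0 t1]; rewrite /idempotent_elt /jrot.
set r := Num.sqrt _.
have rr : r * r = t * (1 - t) by rewrite -expr2 sqr_sqrtr// mulr_ge0// subr_ge0.
rewrite !expandE !scalerA !(jmulC w) (jmulC a c) ca cw aw ww.
rewrite (_ : c ** c = c)// (_ : a ** a = a)// !scalerA rr.
by apply: inner_ext => v; rewrite !expandE; field.
Qed.

(** A primitive g below the rotated idempotent f lies in V_1(c + a), so it is not orthogonal to both
    c and a. Hence <g, g> = <c, c> = <f, f>, which forces g = f. *)
Lemma jrot_primitive c a w t : primitive_idempotent c ->
  primitive_idempotent a -> '<c, c> = '<a, a> -> linked c a w ->
  0 <= t <= 1 -> primitive_idempotent (jrot c a w t).
Proof.
move=> cP aP ca_norm L t01; have [cc c0 _] := cP; have [aa a0 _] := aP.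
have [ca cw aw ww] := L.
have ff := jrot_idem cc aa L t01.
have fN : '<jrot c a w t, jrot c a w t> = '<c, c>.
  rewrite (idem_norm ff) /jrot !expandE (one_half cw cc) -!idem_norm// -ca_norm.
  by ring.
have f0 : jrot c a w t != 0 by rewrite -inner_eq0 fN inner_eq0.
have [g [gP fg]] := exists_primitive ff f0; have [gg g0 _] := gP.
have pg : (c + a) ** g = g by apply: idem_trans fg => //; exact: linked_unit.
have gN : '<g, g> = '<c, c>.
  have [gc|gc] := eqVneq '<g, c> 0; last exact: primitive_norm.
  rewrite ca_norm; apply: primitive_norm => //; apply: contraNneq g0 => ga.
  rewrite -inner_eq0 -{1}pg (jmulC _ g) inner_sym (_ : g ** g = g)// innerDl.
  by rewrite !(innerC _ g) gc ga addr0.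
by rewrite -(idem_le_eq ff gg fg)// gN fN.
Qed.

End Rotation.

(** * Paths of orthogonal families *)

Lemma continuous_compose (T U W : topologicalType) (f : T -> U) (g : U -> W) :
  continuous f -> continuous g -> continuous (fun x => g (f x)).
Proof. by move=> fc gc x; apply: continuous_comp; [exact: fc|exact: gc]. Qed.

Section Clamp.
Variable R : realType.

(** Paths of families are defined and continuous on all of R; [clamp] freezes them outside
    [0, 1]. *)
Definition clamp (t : R) := Num.max 0 (Num.min 1 t).

Lemma clamp_itv t : 0 <= clamp t <= 1.
Proof.
rewrite /clamp; have [t1|t1] := leP 1 t; first by rewrite max_r ler01 ?lexx.
by have [t0|t0] := leP 0 t; rewrite ?lexx ?ler01 ?t0 ?ltW.
Qed.

Lemma clamp_le0 t : t <= 0 -> clamp t = 0.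
Proof.
move=> t0; rewrite /clamp min_r; last exact: le_trans t0 ler01.
by rewrite max_l.
Qed.

Lemma clamp_ge1 t : 1 <= t -> clamp t = 1.
Proof. by move=> t1; rewrite /clamp min_l// max_r. Qed.

Lemma continuous_clamp : continuous clamp.
Proof.
move=> t; apply: (@continuous_max R R (fun=> 0) (fun t => Num.min 1 t)).
  exact: cvg_cst.
by apply: (@continuous_min R R (fun=> 1) id); [exact: cvg_cst|exact: cvg_id].
Qed.

End Clamp.

Lemma pairwise_perm (T : eqType) (r : rel T) (s t : seq T) :
  symmetric r -> perm_eq s t -> pairwise r s -> pairwise r t.
Proof.
move=> r_sym; elim: s t => [|x s IHs] t st.
  by move/perm_size/esym/size0nil: st => ->.
have xt : x \in t by rewrite -(perm_mem st) mem_head.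
case/splitPr: xt st => t1 t2; rewrite perm_sym perm_catC cat_cons perm_cons.
rewrite perm_catC perm_sym => st /= /andP[xs /(IHs _ st)].
move: xs; rewrite (perm_all _ st) all_cat !pairwise_cat /= allrel_consr.
move=> /andP[x1 ->] /and3P[-> -> ->]; rewrite !andbT.
by apply: sub_all x1 => y; rewrite r_sym.
Qed.

Section FramePaths.
Variables (R : realType) (V : euclideanJordanType R).
Implicit Types (a c d p w : V) (s t u : seq V) (l tau : R) (G : seq (R -> V)).

Lemma pfam_perm p s t : perm_eq s t -> pfam p s -> pfam p t.
Proof.
move=> st [sP ss sp]; split.
- by move=> c; rewrite -(perm_mem st); exact: sP.
- by apply: (pairwise_perm _ st) => // x y; rewrite jmulC.
- by rewrite -(perm_big _ st).
Qed.

Definition eval_at G tau := [seq g tau | g <- G].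

(** Positions count: each entry of s moves to the entry of t with the same index. Indices beyond the
    size yield the constant path 0. *)
Definition frame_path p s t := exists G,
  [/\ forall i, continuous (nth (fun=> 0) G i), eval_at G 0 = s, eval_at G 1 = t &
      forall tau, pfam p (eval_at G tau)].

Lemma nth_eval_at G tau i : nth 0 (eval_at G tau) i = nth (fun=> 0) G i tau.
Proof.
have [iG|iG] := ltnP i (size G); first by rewrite (nth_map (fun=> 0)).
by rewrite !nth_default// size_map.
Qed.

Lemma frame_path_size p s t : frame_path p s t -> size s = size t.
Proof. by move=> [G [_ <- <- _]]; rewrite !size_map. Qed.

Lemma frame_path_pfam p s t : frame_path p s t -> pfam p s /\ pfam p t.
Proof. by move=> [G [_ <- <- H]]. Qed.

Lemma frame_path_refl p s : pfam p s -> frame_path p s s.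
Proof.
move=> ps; pose G := [seq (fun=> c) | c <- s] : seq (R -> V).
have eval_at_G tau : eval_at G tau = s by rewrite /eval_at -map_comp map_id.
exists G; split=> [i||| tau]; rewrite ?eval_at_G //.
have [iG|iG] := ltnP i (size s).
  rewrite (nth_map 0)//; exact: cst_continuous.
by rewrite nth_default ?size_map//; exact: cst_continuous.
Qed.

Lemma frame_path_trans p s t u : frame_path p s t -> frame_path p t u -> frame_path p s u.
Proof.
move=> [G [Gc G0 G1 GP]] [H [Hc H0 H1 HP]].
have sGH : size H = size G.
  by rewrite -(size_map (fun g => g 1) G) -/(eval_at G 1) G1 -H0 size_map.
(* The difference with [t] makes the concatenation globally continuous: at each
   time one of the two terms is [t]. *)
pose g i tau := nth (fun=> 0) G i (clamp (2 * tau)) +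
  nth (fun=> 0) H i (clamp (2 * tau - 1)) - nth 0 t i.
pose K := mkseq g (size G).
have eval_left tau : tau <= 2^-1 -> eval_at K tau = eval_at G (clamp (2 * tau)).
  move=> t2; apply: (@eq_from_nth _ 0); rewrite !size_map size_iota// => i iG.
  rewrite nth_eval_at nth_mkseq// /g nth_eval_at (@clamp_le0 _ (2 * tau - 1)); last lra.
  by rewrite -(nth_eval_at H) H0 addrK.
have eval_right tau : 2^-1 <= tau -> eval_at K tau = eval_at H (clamp (2 * tau - 1)).
  move=> t2; apply: (@eq_from_nth _ 0); rewrite !size_map size_iota// => i iG.
  rewrite nth_eval_at nth_mkseq// /g nth_eval_at clamp_ge1; last lra.
  by rewrite -(nth_eval_at G) G1 addrAC subrr add0r.
exists K; split.
- move=> i; have [iG|iG] := ltnP i (size G); last first.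
    by rewrite nth_default ?size_mkseq//; exact: cst_continuous.
  rewrite nth_mkseq// => tau; apply: cvgB; last exact: cvg_cst.
  have c2 : continuous (fun x : R => 2 * x).
    by move=> x; apply: cvgM; [exact: cvg_cst|exact: cvg_id].
  have c21 : continuous (fun x : R => 2 * x - 1).
    by move=> x; apply: cvgB; [exact: c2|exact: cvg_cst].
  have cG := continuous_compose (continuous_compose c2 (@continuous_clamp R)) (Gc i).
  have cH := continuous_compose (continuous_compose c21 (@continuous_clamp R)) (Hc i).
  by apply: cvgD; [exact: cG|exact: cH].
- by rewrite eval_left ?invr_ge0// mulr0 clamp_le0.
- rewrite eval_right; last lra.
  by rewrite clamp_ge1//; lra.
- by move=> tau; have [/eval_left ->//|/ltW/eval_right->] := leP tau 2^-1.
Qed.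

(** The functions of the path are reordered; a common index list expresses that both ends undergo
    the same reordering. *)
Lemma frame_path_reindex (I : eqType) p (c d : I -> V) (e e' : seq I) :
  perm_eq e e' -> frame_path p (map c e) (map d e) -> frame_path p (map c e') (map d e').
Proof.
case: e => [|x0 e1].
  by move=> /perm_size/esym/size0nil ->.
set e := x0 :: e1; rewrite perm_sym => /(perm_iotaP x0)[Is pIs ->].
move=> [G [Gc G0 G1 GP]].
have sG : size G = size e.
  by rewrite -(size_map (fun g => g 0) G) -/(eval_at G 0) G0 size_map.
pose K := [seq nth (fun=> 0) G i | i <- Is].
have eval_at_K tau : eval_at K tau = [seq nth 0 (eval_at G tau) i | i <- Is].
  by rewrite /eval_at -map_comp; apply: eq_map => i /=; rewrite -nth_eval_at.
have Ie i : i \in Is -> (i < size e)%N.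
  by rewrite (perm_mem pIs) mem_iota.
exists K; split.
- move=> i; have [iG|iG] := ltnP i (size Is); last first.
    by rewrite nth_default ?size_map//; exact: cst_continuous.
  by rewrite (nth_map 0%N)//; exact: Gc.
- rewrite eval_at_K G0 -map_comp; apply/eq_in_map => i /Ie ie.
  by rewrite (nth_map x0).
- rewrite eval_at_K G1 -map_comp; apply/eq_in_map => i /Ie ie.
  by rewrite (nth_map x0).
- move=> tau; apply: pfam_perm (GP tau); rewrite perm_sym eval_at_K.
  apply/(perm_iotaP 0); exists Is => //.
  by rewrite size_map sG.
Qed.

Lemma frame_path_perm p s t s' : perm_eq s s' -> frame_path p s t ->
  exists2 t', perm_eq t t' & frame_path p s' t'.
Proof.
move=> ss' st; have sz := frame_path_size st.
have /(perm_iotaP 0)[Is pIs s'E] : perm_eq s' s by rewrite perm_sym.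
exists [seq nth 0 t i | i <- Is].
  rewrite perm_sym; apply/(perm_iotaP 0); exists Is => //.
  by rewrite -sz.
rewrite s'E; apply: (@frame_path_reindex _ p (nth 0 s) (nth 0 t) (iota 0 (size s))).
  by rewrite perm_sym.
rewrite -[X in frame_path _ X _]/(mkseq _ _) mkseq_nth.
by rewrite sz -[X in frame_path _ _ X]/(mkseq _ _) mkseq_nth.
Qed.

Lemma frame_path_cons p c s t : primitive_idempotent c -> c ** p = 0 ->
  frame_path p s t -> frame_path (c + p) (c :: s) (c :: t).
Proof.
move=> cP cp [G [Gc G0 G1 GP]]; exists ((fun=> c) :: G); split.
- by move=> [|i]; [exact: cst_continuous|exact: Gc].
- by rewrite /= G0.
- by rewrite /= G1.
- move=> tau; apply: (@pfam_cat _ _ _ _ [:: c]) => //; last exact: GP.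
  by apply/pfam_cons; split=> //; rewrite subrr; split=> //; rewrite big_nil.
Qed.

(** The rotation takes place in V_1(c + a), and c + a annihilates the elements of s, which stay
    fixed. *)
Lemma frame_path_rot p c a w l s : pfam p [:: c, a & s] -> '<c, c> = '<a, a> ->
  linked c a w -> 0 <= l <= 1 ->
  frame_path p [:: c, a & s] [:: jrot c a w l, c + a - jrot c a w l & s].
Proof.
move=> pcas ca_norm L /andP[l0 l1].
have := pcas => /pfam_cons[cP cs /pfam_cons[aP as_ ps]].
have [cc _ _] := cP; have [aa _ _] := aP; have [ca cw aw ww] := L.
(* The parameter goes from 1, where [jrot] is c, to l; clamping keeps it in [0, 1] at all times. *)
pose h tau := 1 - (1 - l) * clamp tau.
have h01 tau : 0 <= h tau <= 1.
  have /andP[t0 t1] := clamp_itv tau; rewrite /h; apply/andP; split; nra.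
have hc : continuous h.
  move=> tau; apply: cvgB; first exact: cvg_cst.
  by apply: cvgM; [exact: cvg_cst|exact: continuous_clamp].
pose g tau := jrot c a w (h tau).
have gc : continuous g.
  move=> tau; apply: cvgD; first apply: cvgD.
  - by apply: cvgZ; [exact: hc|exact: cvg_cst].
  - apply: cvgZ; last exact: cvg_cst.
    by apply: cvgB; [exact: cvg_cst|exact: hc].
  - apply: cvgZ; last exact: cvg_cst.
    apply: (@continuous_compose R R R (fun x => h x * (1 - h x)) Num.sqrt).
      move=> x; apply: cvgM; first exact: hc.
      by apply: cvgB; [exact: cvg_cst|exact: hc].
    exact: sqrt_continuous.
have h0 : h 0 = 1 by rewrite /h clamp_le0// mulr0 subr0.
have h1 : h 1 = l by rewrite /h clamp_ge1// mulr1 subKr.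
exists [:: g, (fun tau => c + a - g tau) & [seq (fun=> d) | d <- s]].
have evs tau : eval_at [seq (fun=> d) | d <- s] tau = s.
  by rewrite /eval_at -map_comp map_id.
split.
- move=> [|[|i]]; first exact: gc.
    by move=> tau /=; apply: cvgB; [exact: cvg_cst|exact: gc].
  have [iG|iG] := ltnP i (size s).
    rewrite /= (nth_map 0)//; exact: cst_continuous.
  by rewrite /= nth_default ?size_map//; exact: cst_continuous.
- by rewrite /= -/(eval_at _ _) evs /g h0 jrot1 addrAC subrr add0r.
- by rewrite /= -/(eval_at _ _) evs /g h1.
move=> tau; rewrite /= -/(eval_at _ _) evs.
have gi := jrot_idem cc aa L (h01 tau); have gu := linked_unit (h tau) cc aa L.
have gP := jrot_primitive cP aP ca_norm L (h01 tau).
have gP' : primitive_idempotent (c + a - g tau).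
  by rewrite jrot_swap; apply: jrot_primitive => //; exact: linked_swap.
have -> : p = (c + a) + (p - c - a) by vring.
apply: (@pfam_cat _ _ _ _ [:: g tau; c + a - g tau]) => //.
- apply/pfam_cons; split=> //.
    by move=> d; rewrite inE => /eqP ->; exact: idem_sub_ortho.
  by apply/pfam_cons; split=> //; rewrite subrr; split=> //; rewrite big_nil.
- have sz d : d \in s -> (c + a) ** d = 0.
    by move=> ds; rewrite jmulDl cs ?as_ ?addr0// in_cons ds orbT.
  have [_ _ <-] := ps; rewrite jmul_sumr big1_seq// => d /sz.
Qed.

(** The order in which a family is reached is not controlled in general, so the end is prescribed
    only up to permutation. *)
Definition conn p s t := exists2 t', perm_eq t t' & frame_path p s t'.

Lemma conn_trans p s t u : conn p s t -> conn p t u -> conn p s u.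
Proof.
move=> [t' tt' st'] [u' uu' tu'].
have [u'' u'u'' t'u''] := frame_path_perm tt' tu'.
exists u''; first exact: perm_trans uu' u'u''.
exact: frame_path_trans t'u''.
Qed.

Lemma conn_perml p s s' t : perm_eq s s' -> conn p s t -> conn p s' t.
Proof.
move=> ss' [u tu su]; have [u' uu' s'u'] := frame_path_perm ss' su.
by exists u' => //; exact: perm_trans uu'.
Qed.

Lemma conn_cons p c s t : primitive_idempotent c -> c ** p = 0 ->
  conn p s t -> conn (c + p) (c :: s) (c :: t).
Proof.
move=> cP cp [t' tt' st']; exists (c :: t'); first by rewrite perm_cons.
exact: frame_path_cons.
Qed.

Lemma conn_size p s t : conn p s t -> size s = size t.
Proof. by move=> [t' /perm_size-> /frame_path_size]. Qed.

Lemma pfam_nil s : pfam 0 s -> s = [::].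
Proof.
case: s => // c s ps; have /pfam_cons[[_ c0 _] _ _] := ps.
by have := pfam_mul ps (mem_head _ _); rewrite jmul0x => c00; rewrite -c00 eqxx in c0.
Qed.

(** Induction on the size of s. With d the head of t and c in s not orthogonal to d, the rest of s
    is moved inside V_1(p - c) to a family starting with a; the pair c, a is rotated to d, c + a -
    d; then the rest is moved inside V_1(p - d) to the tail of t. *)
Lemma pfam_conn p s t : pfam p s -> pfam p t -> conn p s t.
Proof.
elim: (size s) {-2}s (erefl (size s)) p t => [|n IHn] {}s sn p t ps pt.
  move: ps; rewrite (size0nil sn) => ps.
  have p0 : p = 0 by case: ps => _ _ <-; rewrite big_nil.
  rewrite p0 in ps pt *; rewrite (pfam_nil pt).
  by exists [::] => //; exact: frame_path_refl.
case: t pt => [|d t] pt.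
  have p0 : p = 0 by case: pt => _ _ <-; rewrite big_nil.
  by rewrite p0 in ps; rewrite (pfam_nil ps) in sn.
have pp := pfam_idem ps; have pd := pfam_mul pt (mem_head _ _).
have /pfam_cons[dP dt pt'] := pt; have [dd d0 _] := dP.
(* Otherwise <p, d> = 0, while <p, d> = <d, d> != 0. *)
have [c cs cd] : exists2 c, c \in s & '<c, d> != 0.
  apply: contrapT => N; have : '<p, d> = 0.
    have [_ _ <-] := ps.
    rewrite (big_morph (fun z => '<z, d>) (fun x y => innerDl x y d) (inner0x d)).
    rewrite big1_seq// => c /= cs; apply/eqP/negPn/negP => cd.
    by apply: N; exists c.
  rewrite -{1}dd innerC inner_sym jmulC pd => /eqP.
  by rewrite inner_eq0 (negPf d0).
have sc := perm_to_rem cs; have ps1 := pfam_perm sc ps.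
rewrite perm_sym in sc; apply: (conn_perml sc).
have sn1 : size (rem c s) = n by rewrite size_rem// sn.
move: (rem c s) ps1 sn1 => s1 {sc} ps1 sn1.
have pc := pfam_mul ps1 (mem_head _ _).
have /pfam_cons[cP cs1 ps1'] := ps1; have [cc c0 _] := cP.
have cpc := idem_sub_ortho cc pc; have dpd := idem_sub_ortho dd pd.
have [cdE|cNd] := eqVneq c d.
  rewrite -cdE -{1}(subrK c p) addrC; apply: conn_cons => //.
  by apply: IHn => //; rewrite cdE.
have [l [a [w [/andP[l0 l1] [aP caN] L dE aleq]]]] := primitive_rank2 cP dP cd cNd.
(* That a lies below p leaves room to complete c and a to a family with sum p. *)
have pa := aleq _ pp pc pd; have [ca _ _ _] := L; have [aa _ _] := aP.
have pca : (p - c) ** a = a by rewrite jmulDl jmulNl pa ca subr0.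
have pci := idem_sub pp cc pc.
have [f fP] := exists_pfam (idem_sub pci aa pca).
have paf : pfam (p - c) (a :: f).
  apply/pfam_cons; split=> // b bf; have := pfam_mul fP bf => pcab.
  by have [] := idem_sub_mul pci aa pca pcab.
have saf := IHn _ sn1 _ _ ps1' paf.
have H1 : conn p (c :: s1) [:: c, a & f].
  by rewrite -{1}(subrK c p) addrC; apply: conn_cons.
apply: conn_trans H1 _.
have pcaf : pfam p [:: c, a & f].
  apply/pfam_cons; split=> // b bf; have := pfam_mul paf bf => pcb.
  by have [] := idem_sub_mul pp cc pc pcb.
have H2 : frame_path p [:: c, a & f] [:: d, c + a - d & f].
  by rewrite dE; apply: frame_path_rot => //; rewrite !ltW.
have [_ /pfam_cons[_ _ pd'f]] := frame_path_pfam H2.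
apply: (@conn_trans _ _ [:: d, c + a - d & f]).
  by exists [:: d, c + a - d & f].
rewrite -{1}(subrK d p) addrC; apply: conn_cons => //.
(* The induction applies a second time because the first path preserved the number of elements. *)
by apply: IHn => //=; rewrite -sn1 (conn_size saf).
Qed.

End FramePaths.

(** * Peirce subalgebras as Euclidean Jordan algebras *)

Section PeirceSubalgebra.
Variables (R : realType) (V : euclideanJordanType R) (p : V).
Hypothesis pp : idempotent_elt p.

(** The proof argument makes this a type of its own, to which structures that require p to be
    idempotent can be attached. *)
Definition peirce_sub of idempotent_elt p := subvs_of (eigsp p 1).
Local Notation T := (peirce_sub pp).

HB.instance Definition _ := Vector.copy T (subvs_of (eigsp p 1)).

Let pval (u : T) : V := vsval u.
Let pval_inj : injective pval. Proof. exact: val_inj. Qed.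

Let pval_eq0 (u : T) : pval u = 0 -> u = 0.
Proof. by move=> u0; apply: pval_inj; rewrite u0 /pval linear0. Qed.

Let norm (u : T) := `|pval u|.

Let norm_D (u v : T) : norm (u + v) <= norm u + norm v.
Proof. by rewrite /norm /pval linearD ler_normD. Qed.

Let norm_Z (k : R) (u : T) : norm (k *: u) = `|k| * norm u.
Proof. by rewrite /norm /pval linearZ normrZ. Qed.

Let norm_eq0 (u : T) : norm u = 0 -> u = 0.
Proof. by move/normr0_eq0; exact: pval_eq0. Qed.

HB.instance Definition _ := Lmodule_isNormed.Build R T norm_D norm_Z norm_eq0.

Let proj (x : V) : T := vsproj (eigsp p 1) x.
(** Products of elements of V_1(p) already lie in V_1(p), so the projection only supplies
    membership. *)
Let mul (u v : T) : T := proj (pval u ** pval v).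
Let ip (u v : T) : R := '<pval u, pval v>.

Lemma peirce_sub_val (u : T) : p ** vsval u = vsval u.
Proof. by apply/eqP; rewrite -memv_peirce1 subvsP. Qed.

Let projK x : p ** x = x -> pval (proj x) = x.
Proof. by move=> px; rewrite /pval /proj vsprojK// memv_peirce1 px. Qed.

Let val_mul u v : pval (mul u v) = pval u ** pval v.
Proof. by rewrite projK// peirce11// peirce_sub_val. Qed.

Let val_lin k u v : pval (k *: u + v) = k *: pval u + pval v.
Proof. by rewrite /pval linearP. Qed.

Let mul_bilin : bilinear_for *:%R *:%R mul.
Proof.
by split=> u k v w; apply: pval_inj; rewrite val_lin !val_mul val_lin
  !expandE.
Qed.

Let mulC : commutative mul.
Proof. by move=> u v; apply: pval_inj; rewrite !val_mul jmulC. Qed.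

Let mul1 : left_id (proj p) mul.
Proof.
by move=> u; apply: pval_inj; rewrite val_mul projK// peirce_sub_val.
Qed.

Let jordan u v : mul u (mul (mul u u) v) = mul (mul u u) (mul u v).
Proof.
by apply: pval_inj; rewrite !val_mul; exact: jordan_identity.
Qed.

Let ip_bilin : bilinear_for *%R *%R ip.
Proof. by split=> u k v w; rewrite /ip val_lin !expandE. Qed.

Let ipC : commutative ip. Proof. by move=> u v; exact: innerC. Qed.

Let ip_gt0 u : u != 0 -> 0 < ip u u.
Proof.
by move=> u0; apply: inner_gt0; apply: contraNneq u0 => u0; apply/eqP/pval_eq0.
Qed.

Let ip_mul u v w : ip (mul u v) w = ip v (mul u w).
Proof. by rewrite /ip !val_mul inner_jmul. Qed.

Let norm_ip u : `|u| = Num.sqrt (ip u u).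
Proof. exact: (norm_inner (pval u)). Qed.

HB.instance Definition _ := isEuclideanJordan.Build R T mul_bilin mulC mul1
  jordan ip_bilin ipC ip_gt0 ip_mul norm_ip.

Definition peirce_subalgebra : euclideanJordanType R := T.

Lemma peirce_sub_mul (u v : peirce_subalgebra) : vsval (jmul u v) = vsval u ** vsval v.
Proof. exact: val_mul. Qed.

Lemma peirce_sub_inner (u v : peirce_subalgebra) : inner u v = '<vsval u, vsval v>.
Proof. by []. Qed.

End PeirceSubalgebra.

(** * Simple algebras *)

Section Simple.
Variables (R : realType) (V : euclideanJordanType R).
Implicit Types (x y z u v w a b p : V) (k : R).

(** If V_{1/2}(p) = 0, then [jmul p] is a projection. Its image V_1(p) and its kernel V_1(e - p)
    annihilate each other and are orthogonal, so V is their direct product; both are nonzero as p is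
    neither 0 nor e. *)
Lemma simple_peirce_half p : simple_jordan V -> idempotent_elt p -> p != 0 ->
  p != jone -> exists u, p ** u = 2^-1 *: u /\ u != 0.
Proof.
move=> [_ Vsimple] pp p0 p1; apply: contrapT => N.
have px x : p ** (p ** x) = p ** x.
  have H : peirceh p x = 0.
    apply/eqP/negPn/negP => h0; apply: N; exists (peirceh p x); split=> //.
    exact: mul_peirceh.
  by rewrite /peirceh in H; apply: inner_ext => v; vect v H; lra.
have qq : idempotent_elt (jone - p).
  by apply: idem_sub => //; [exact: idem_one|exact: jmul1].
have qE x : (jone - p) ** x = x - p ** x by rewrite jmulDl jmulNl jmul1.
pose V1 := peirce_subalgebra pp; pose V2 := peirce_subalgebra qq.
have V1E (a : V1) : p ** vsval a = vsval a by exact: peirce_sub_val.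
have V2E (b : V2) : p ** vsval b = 0.
  have := peirce_sub_val (b : peirce_sub qq).
  by rewrite qE => /eqP; rewrite -subr_eq0 addrAC subrr add0r oppr_eq0 => /eqP.
pose f (ab : V1 * V2) : V := vsval ab.1 + vsval ab.2.
have f_lin : linear f.
  by move=> k [a b] [a' b']; rewrite /f /= scalerDr addrACA.
pose F : {linear (V1 * V2)%type -> V} :=
  HB.pack f (GRing.isLinear.Build R (V1 * V2)%type V *:%R f f_lin).
have pf ab : p ** f ab = vsval ab.1 by rewrite /f jmulDr V1E V2E addr0.
apply: Vsimple; exists V1, V2; split.
- exists (vsproj (eigsp p 1) p : V1); apply: contraNneq p0 => e0.
  rewrite -[p](vsprojK (U := eigsp p 1)); last by rewrite memv_peirce1 pp.
  by rewrite [vsproj _ _]e0 linear0.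
- exists (vsproj (eigsp (jone - p) 1) (jone - p) : V2).
  apply: contraNneq p1 => e0.
  rewrite eq_sym -subr_eq0 -[_ - _](vsprojK (U := eigsp (jone - p) 1)).
    by rewrite [vsproj _ _]e0 linear0.
  by rewrite memv_peirce1 qq.
exists F; split.
- exists (fun x => (vsproj (eigsp p 1) (p ** x) : V1,
                    vsproj (eigsp (jone - p) 1) ((jone - p) ** x) : V2)).
    move=> [a b]; rewrite qE pf /f /= addrAC subrr add0r; congr pair.
      exact: vsvalK.
    exact: vsvalK.
  move=> x; rewrite /F /= /f /= !vsprojK ?memv_peirce1.
  + by rewrite qE addrC subrK.
  + by rewrite !qE jmulDr jmulNr px subrr subr0.
  + by rewrite px.
- move=> [a b] [a' b']; rewrite /F /= /f /= !peirce_sub_mul.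
  have ab : vsval a ** vsval b' = 0 by apply: (peirce10 pp); rewrite ?V1E ?V2E.
  have ba : vsval b ** vsval a' = 0.
    by rewrite jmulC; apply: (peirce10 pp); rewrite ?V1E ?V2E.
  by rewrite !expandE ab ba addr0 add0r.
- move=> [a b] [a' b']; rewrite /F /= /f /= !peirce_sub_inner !expandE.
  have o (c : V1) (d : V2) : '<vsval c, vsval d> = 0.
    by apply: (@inner_eigen _ _ p _ _ 1 0); rewrite ?V1E ?V2E ?scale1r ?scale0r//.
  by rewrite o (innerC (vsval b)) o addr0 add0r.
Qed.

(** As u lies in V_1(c + a), u u = k c + l a, and the Jordan identity for u and c forces k = l. Then
    k <c, c> and k <a, a> both equal <u, u> / 2, so k > 0 and w = k^(-1/2) u. *)
Lemma linked_exists c a u : primitive_idempotent c -> primitive_idempotent a ->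
  c ** a = 0 -> c ** u = 2^-1 *: u -> a ** u = 2^-1 *: u -> u != 0 ->
  '<c, c> = '<a, a> /\ exists w, linked c a w.
Proof.
move=> cP aP ca cu au u0; have [cc c0 _] := cP; have [aa a0 _] := aP.
have ac : a ** c = 0 by rewrite jmulC.
have [k kE] := primitive_peirce1 cP (peirce_half_sq cc cu).
have [l lE] := primitive_peirce1 aP (peirce_half_sq aa au).
have uu : u ** u = k *: c + l *: a.
  rewrite -kE -lE -jmulDl; apply/esym.
  have sa : idempotent_elt (c + a) by apply: idem_add.
  have su : (c + a) ** u = u.
    by rewrite jmulDl cu au; vring.
  by rewrite peirce11.
have kl : k = l.
  have H := jordan_identity u c; rewrite (jmulC (u ** u) c) kE (jmulC u c) cu in H.
  rewrite jmulZr uu jmulZr !expandE (jmulC u) cu au in H.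
  have E : (k - l) *: u = 0.
    apply: inner_ext => v; vect v H; rewrite ?expandE; lra.
  by move/eqP: E; rewrite scaler_eq0 (negPf u0) orbF subr_eq0 => /eqP.
have norm_half d : idempotent_elt d -> d ** u = 2^-1 *: u ->
    '<d ** (u ** u), d> = 2^-1 * '<u, u>.
  move=> dd du; rewrite inner_sym (_ : d ** d = d)// inner_sym jmulC du.
  by rewrite innerZr.
have ck := norm_half c cc cu; have al := norm_half a aa au.
rewrite kE innerZl in ck; rewrite lE innerZl -kl in al.
have k0 : 0 < k.
  by rewrite -(pmulr_lgt0 _ (inner_gt0 c c0)) ck mulr_gt0 ?inner_gt0// invr_gt0.
have kn0 : k != 0 by rewrite gt_eqF.
split; first by apply: (mulfI kn0); rewrite ck al.
exists ((Num.sqrt k)^-1 *: u); split=> //.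
- by rewrite jmulZr cu !scalerA mulrC.
- by rewrite jmulZr au !scalerA mulrC.
- rewrite !expandE scalerA -invfM -expr2 sqr_sqrtr ?ltW// uu -kl -scalerDr.
  by rewrite scalerA mulVf// scale1r.
Qed.

(** By primitivity c u is a multiple of c plus an element of V_{1/2}(c); [jmul a] kills c and
    preserves V_{1/2}(c). *)
Lemma joint_half c a u : primitive_idempotent c -> idempotent_elt a ->
  c ** a = 0 -> c ** (a ** (c ** u)) = 2^-1 *: (a ** (c ** u)).
Proof.
move=> cP aa ca; have [cc _ _] := cP.
have [k kE] := primitive_peirce1 cP (mul_peirce1 u cc).
have cuE : c ** u = k *: c + 2^-1 *: peirceh c u.
  by rewrite -kE /peirce1 /peirceh; vring.
have hE := mul_peirceh u cc; move: (peirceh c u) hE cuE => h hE ->.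
rewrite !jmulDr !jmulZr (jmulC a c) ca jmulx0 !scaler0 !add0r.
by rewrite idem_comm// hE jmulZr.
Qed.

End Simple.

(** * Paths of Jordan frames and their permutations *)

Section JordanFrames.
Variables (R : realType) (V : euclideanJordanType R).
Implicit Types (x y z u v w a b p : V).

Lemma nth_map_ord n (c : 'I_n -> V) (i : 'I_n) :
  nth 0 [seq c j | j <- enum 'I_n] i = c i.
Proof. by rewrite (nth_map i) ?size_enum_ord// nth_ord_enum. Qed.

Lemma frame_pfam n (c : 'I_n -> V) :
  jordan_frame c <-> pfam jone [seq c i | i <- enum 'I_n].
Proof.
have sE : \sum_(x <- [seq c i | i <- enum 'I_n]) x = \sum_(i < n) c i.
  by rewrite big_map big_enum.
rewrite /pfam sE; split=> -[cP co cs]; split=> //.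
- by move=> _ /mapP[i _ ->].
- rewrite pairwise_map; apply: (@sub_pairwise _ (fun i j => i != j)).
    by move=> i j /co cij /=; rewrite cij.
  by rewrite -uniq_pairwise enum_uniq.
- by move=> i; apply: cP; rewrite map_f// mem_enum.
- move=> i j; wlog ij : i j / (i < j)%N => [H|] ineqj.
    by have := ineqj; rewrite neq_ltn => /orP[/H->//|/H]; rewrite jmulC eq_sym => ->.
  move/(pairwiseP 0): co => /(_ i j); rewrite !inE size_map size_enum_ord.
  rewrite !nth_map_ord => H.
  by apply/eqP/H.
Qed.

Lemma frame_path_frame n (c d : 'I_n -> V) :
  frame_path jone [seq c i | i <- enum 'I_n] [seq d i | i <- enum 'I_n] ->
  exists g : 'I_n -> R -> V, [/\ forall i, continuous (g i), g^~ 0 =1 c,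
    g^~ 1 =1 d & forall tau, jordan_frame (g^~ tau)].
Proof.
move=> [G [Gc G0 G1 GP]]; exists (fun i => nth (fun=> 0) G i).
have sG : size G = n.
  by rewrite -(size_map (fun g => g 0) G) -/(eval_at G 0) G0 size_map size_enum_ord.
split=> [i|i|i|tau]; first exact: Gc.
- by rewrite -nth_eval_at G0 nth_map_ord.
- by rewrite -nth_eval_at G1 nth_map_ord.
apply/frame_pfam; have := GP tau; congr pfam; apply: (@eq_from_nth _ 0).
  by rewrite size_map size_map size_enum_ord.
move=> i; rewrite size_map sG => iN.
by rewrite nth_eval_at (nth_map_ord _ (Ordinal iN)).
Qed.

Lemma frames_conn n (c d : 'I_n -> V) : jordan_frame c -> jordan_frame d ->
  exists s : 'S_n,
    frame_path jone [seq c i | i <- enum 'I_n] [seq d (s i) | i <- enum 'I_n].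
Proof.
move=> /frame_pfam cP /frame_pfam dP.
have [t' dt' ct'] := pfam_conn cP dP.
have dtE : [seq d i | i <- enum 'I_n] = [tuple d i | i < n] by [].
move: dt'; rewrite dtE perm_sym => /tuple_permP[s t'E].
exists s; move: ct'; rewrite t'E; congr frame_path.
by rewrite /=; apply: eq_map => i; rewrite tnth_mktuple.
Qed.

Lemma frame_path_swap n (c : 'I_n -> V) (i j : 'I_n) w : jordan_frame c ->
  i != j -> '<c i, c i> = '<c j, c j> -> linked (c i) (c j) w ->
  frame_path jone [seq c k | k <- enum 'I_n] [seq c (tperm i j k) | k <- enum 'I_n].
Proof.
move=> /frame_pfam cP ij cN L.
(* The rotation acts on the first two entries, so i and j are brought to the front of the
   enumeration. *)
pose r := [seq k <- enum 'I_n | (k != i) && (k != j)].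
have eE : perm_eq [:: i, j & r] (enum 'I_n).
  apply: uniq_perm; rewrite ?enum_uniq//=.
    by rewrite filter_uniq ?enum_uniq// andbT !inE !mem_filter !eqxx negb_or ij andbF.
  move=> k; rewrite !inE mem_filter !mem_enum !inE andbT.
  by case: (k == i); case: (k == j).
apply: (frame_path_reindex eE) => /=.
have -> : [seq c (tperm i j k) | k <- r] = [seq c k | k <- r].
  apply/eq_in_map => k; rewrite mem_filter => /andP[/andP[ki kj] _].
  by rewrite tpermD// eq_sym.
have {}cP : pfam jone [:: c i, c j & [seq c k | k <- r]].
  apply: pfam_perm cP; rewrite perm_sym.
  by rewrite -[X in perm_eq X]/(map c [:: i, j & r]) perm_map.
rewrite tpermL tpermR.
have := frame_path_rot (l := 0) cP cN L; rewrite jrot0 addrK; apply.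
by rewrite lexx ler01.
Qed.

(** Let p be the sum over A and u != 0 in V_{1/2}(p). Some c_i u with i in A is nonzero, and e - p
    still acts on it by 1/2, so some c_j (c_i u) with j outside A is nonzero. This vector lies in
    both V_{1/2}(c_i) and V_{1/2}(c_j). *)
Lemma simple_linked n (c : 'I_n -> V) (A : pred 'I_n) (i0 j0 : 'I_n) :
  simple_jordan V -> jordan_frame c -> A i0 -> ~~ A j0 ->
  exists i j, [/\ A i, ~~ A j, '<c i, c i> = '<c j, c j> &
    exists w, linked (c i) (c j) w].
Proof.
move=> Vsimple cF Ai0 Aj0; have [cP co cs] := cF.
have cidem i : c i ** c i = c i by case: (cP i).
pose p := \sum_(i | A i) c i.
have sumE (P : pred 'I_n) x : (\sum_(i | P i) c i) ** x = \sum_(i | P i) c i ** x.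
  by rewrite jmulC linear_sum; apply: eq_bigr => i _; rewrite jmulC.
have pE i : p ** c i = if A i then c i else 0.
  rewrite /p sumE; case: ifP => Ai.
    rewrite (bigD1 i)//= cidem big1 ?addr0// => j /andP[_ ji]; exact: co.
  by apply: big1 => j Aj; apply: co; apply: contraTneq Aj => ->; rewrite Ai.
have pp : idempotent_elt p.
  rewrite /idempotent_elt {2}/p linear_sum /=.
  by apply: eq_bigr => i Ai; rewrite pE Ai.
have p0 : p != 0.
  have [_ ci0 _] := cP i0; apply: contraNneq ci0 => p0.
  by have := pE i0; rewrite Ai0 p0 jmul0x => <-; rewrite eqxx.
have p1 : p != jone.
  have [_ cj0 _] := cP j0; apply: contraNneq cj0 => p1.
  by have := pE j0; rewrite (negPf Aj0) p1 jmul1 => ->.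
have qE : jone - p = \sum_(i | ~~ A i) c i.
  by rewrite -cs (bigID A)/= addrAC subrr add0r.
have [u [pu u0]] := simple_peirce_half Vsimple pp p0 p1.
have [i [Ai cu0]] : exists i, A i /\ c i ** u != 0.
  apply: contrapT => N; suff : p ** u = 0.
    by rewrite pu => /eqP; rewrite scaler_eq0 (negPf u0) orbF invr_eq0 pnatr_eq0.
  rewrite /p sumE big1// => i Ai; apply/eqP/negPn/negP => cu0; apply: N.
  by exists i.
have comm j : ~~ A j -> c i ** (c j ** u) = c j ** (c i ** u).
  move=> Aj; apply: idem_comm; first exact: cidem.
  by apply: co; apply: contraNneq Aj => <-.
have qu : (jone - p) ** (c i ** u) = 2^-1 *: (c i ** u).
  rewrite qE sumE (eq_bigr (fun j => c i ** (c j ** u))); last first.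
    by move=> j Aj; rewrite comm.
  rewrite -linear_sum -sumE -qE jmulDl jmulNl jmul1 pu -jmulZr.
  by congr (_ ** _); vring.
have [j [Aj cju0]] : exists j, ~~ A j /\ c j ** (c i ** u) != 0.
  apply: contrapT => N; suff : (jone - p) ** (c i ** u) = 0.
    by rewrite qu => /eqP; rewrite scaler_eq0 (negPf cu0) orbF invr_eq0 pnatr_eq0.
  rewrite qE sumE big1// => j Aj; apply/eqP/negPn/negP => cju0; apply: N.
  by exists j.
have ij : i != j by apply: contraNneq Aj => <-.
have ji : j != i by rewrite eq_sym.
have ci := joint_half u (cP i) (cidem j) (co _ _ ij).
have cj := joint_half u (cP j) (cidem i) (co _ _ ji).
rewrite (comm j Aj) in cj.
have [cN wL] := linked_exists (cP i) (cP j) (co _ _ ij) ci cj cju0.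
by exists i, j.
Qed.

(** The realizable permutations are closed under products. If the j with (i0 j) realizable did not
    exhaust the indices, a linked pair i, j would leave this set, yet (i0 j) is the conjugate of (i0
    i) by (i j). *)
Lemma simple_frame_path_perm n (c : 'I_n -> V) (s : 'S_n) : simple_jordan V ->
  jordan_frame c ->
  frame_path jone [seq c i | i <- enum 'I_n] [seq c (s i) | i <- enum 'I_n].
Proof.
move=> Vsimple cF; have [cP _ _] := cF; have /frame_pfam cfam := cF.
pose S (s : 'S_n) :=
  frame_path jone [seq c i | i <- enum 'I_n] [seq c (s i) | i <- enum 'I_n].
have S1 : S 1%g.
  rewrite /S (_ : map _ _ = [seq c i | i <- enum 'I_n]); first exact: frame_path_refl.
  by apply: eq_map => i; rewrite perm1.
have SM s1 s2 : S s1 -> S s2 -> S (s1 * s2)%g.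
  move=> S1' S2'; apply: frame_path_trans S1' _.
  (* Reindexed along s1, the path for s2 starts where the path for s1 ends. *)
  have sE : perm_eq (enum 'I_n) [seq s1 i | i <- enum 'I_n].
    rewrite perm_sym; apply: uniq_perm; rewrite ?enum_uniq//.
      by rewrite map_inj_uniq ?enum_uniq//; exact: perm_inj.
    move=> k; rewrite mem_enum; apply/mapP; exists ((s1^-1)%g k).
      by rewrite mem_enum.
    by rewrite permKV.
  have := frame_path_reindex sE S2'; rewrite -!map_comp; congr frame_path.
  by apply: eq_map => k /=; rewrite permM.
have Sswap i0 j0 : S (tperm i0 j0).
  pose A := [pred j | `[< S (tperm i0 j) >]].
  suff : A j0 by move/asboolP.
  apply/negPn/negP => Aj0.
  have Ai0 : A i0 by apply/asboolP; rewrite tperm1.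
  have [i [j [/asboolP Ai Aj cN [w L]]]] := simple_linked Vsimple cF Ai0 Aj0.
  have ij : i != j by apply: contraNneq Aj => <-; apply/asboolP.
  have Sij : S (tperm i j) by exact: frame_path_swap L.
  case/negP: Aj; apply/asboolP.
  have [<-//|i0i] := eqVneq i i0.
  have [->|ji0] := eqVneq j i0; first by rewrite tperm1.
  have -> : tperm i0 j = (tperm i j * tperm i0 i * tperm i j)%g.
    rewrite -{1}(tpermV i j) -mulgA -/(conjg _ _) tpermJ tpermL tpermD//.
  exact: (SM _ _ (SM _ _ Sij Ai) Sij).
have [ts -> _] := prod_tpermP s.
by rewrite -/(S _); apply: (big_ind S) => // t _; exact: Sswap.
Qed.

Lemma simple_frames_conn n (c d : 'I_n -> V) : simple_jordan V ->
  jordan_frame c -> jordan_frame d ->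
  frame_path jone [seq c i | i <- enum 'I_n] [seq d i | i <- enum 'I_n].
Proof.
move=> Vsimple cF dF; have [s cds] := frames_conn cF dF.
have dsF : jordan_frame (d \o s).
  by apply/frame_pfam; have [_] := frame_path_pfam cds.
apply: frame_path_trans cds _.
have := simple_frame_path_perm s^-1%g Vsimple dsF; congr frame_path.
by apply: eq_map => i /=; rewrite permKV.
Qed.

End JordanFrames.

(** * Uniqueness of the eigenvalues *)

Section Eigenvalues.
Variables (R : realType) (V : euclideanJordanType R).
Implicit Types (x y z u v w a b p : V) (s t : seq (R * V)) (k : R).

Definition weighted_sum s : V := \sum_(e <- s) e.1 *: e.2.
(** The spectral idempotent of the eigenvalue k. *)
Definition eigensum s k : V := \sum_(e <- s | e.1 == k) e.2.

Lemma weighted_sum_eigen p s e : pfam p (map snd s) -> e \in s ->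
  weighted_sum s ** e.2 = e.1 *: e.2.
Proof.
rewrite /weighted_sum; elim: s p => // e0 s IHs p /pfam_cons[[cc _ _] cs ps].
have sc f : f \in s -> e0.2 ** f.2 = 0 by move=> fs; rewrite cs// map_f.
rewrite in_cons big_cons jmulDl jmulZl => /orP[/eqP->|es].
  rewrite (_ : e0.2 ** e0.2 = e0.2)// jmulC linear_sum big1_seq ?addr0//.
  by move=> f /= fs; rewrite jmulZr sc// scaler0.
by rewrite sc// scaler0 add0r; exact: IHs ps es.
Qed.

Lemma eigensum_pfam p s k : pfam p (map snd s) ->
  pfam (eigensum s k) (map snd [seq e <- s | e.1 == k]).
Proof.
move=> [sP ss _].
have sub : subseq (map snd [seq e <- s | e.1 == k]) (map snd s).
  by apply: map_subseq; exact: filter_subseq.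
split; last by rewrite big_map big_filter.
- by move=> c /(mem_subseq sub); exact: sP.
- exact: subseq_pairwise sub ss.
Qed.

Lemma eigensum_mul p s k : pfam p (map snd s) -> p ** eigensum s k = eigensum s k.
Proof.
move=> ps; rewrite /eigensum -big_filter linear_sum /=; apply: eq_big_seq => e.
by rewrite mem_filter => /andP[_ es]; apply: pfam_mul ps _; exact: map_f.
Qed.

(** An e of s with eigenvalue k and an f of t with another eigenvalue are eigenvectors of the same
    self-adjoint operator, so they are orthogonal and e f = 0. Thus [eigensum t k] acts on
    [eigensum s k] as p does. *)
Lemma eigensum_le p s t k : pfam p (map snd s) -> pfam p (map snd t) ->
  weighted_sum s = weighted_sum t -> eigensum s k ** eigensum t k = eigensum s k.
Proof.
move=> ps pt st; rewrite -[RHS](eigensum_mul k ps) jmulC [RHS]jmulC.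
have [_ _ <-] := pt; rewrite big_map (bigID (fun e => e.1 == k))/= jmulDr.
rewrite jmulC -[LHS]addr0; congr (_ + _).
rewrite linear_sum /= -big_filter big1_seq// => f /=.
rewrite mem_filter => /andP[fk ft]; rewrite jmulC /eigensum -big_filter linear_sum.
rewrite big1_seq// => e /=; rewrite mem_filter => /andP[/eqP ek es].
have [fi _ _] : primitive_idempotent f.2.
  by have [tP _ _] := pt; apply: tP; exact: map_f.
have [ei _ _] : primitive_idempotent e.2.
  by have [sP _ _] := ps; apply: sP; exact: map_f.
apply: idem_ortho => //.
apply: (@inner_eigen _ _ (weighted_sum s) _ _ f.1 e.1); last by rewrite ek.
  by rewrite st; exact: weighted_sum_eigen pt ft.
exact: weighted_sum_eigen ps es.
Qed.

(** Both lists have the same spectral idempotents, and the multiplicity of k is the common size of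
    the families with sum [eigensum s k]. *)
Lemma weighted_sum_perm p s t : pfam p (map snd s) -> pfam p (map snd t) ->
  weighted_sum s = weighted_sum t -> perm_eq (map fst s) (map fst t).
Proof.
move=> ps pt st; apply/allP => k _ /=; rewrite !count_map -!size_filter; apply/eqP.
have E : eigensum s k = eigensum t k.
  by rewrite -(eigensum_le k ps pt st) jmulC (eigensum_le k pt ps (esym st)).
have sk := eigensum_pfam k ps; have tk := eigensum_pfam k pt; rewrite -E in tk.
by have := conn_size (pfam_conn sk tk); rewrite !size_map.
Qed.

End Eigenvalues.

(** * Permutations and decreasing rearrangements of vectors *)

Section Rearrangement.
Variables (R : realType) (n : nat).
Implicit Types q r : 'rV[R]_n.

Definition permute q (s : 'S_n) : 'rV[R]_n := \row_i q ord0 (s i).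

Lemma entries_perm q r :
  perm_eq [seq r ord0 j | j : 'I_n] [seq q ord0 j | j : 'I_n] ->
  exists s, r = permute q s.
Proof.
move=> rq.
have : perm_eq [seq r ord0 j | j : 'I_n] [tuple q ord0 j | j < n] by [].
move=> /tuple_permP[s E]; exists s; apply/rowP => i; rewrite mxE.
have := congr1 (fun l => nth 0 l i) E.
rewrite (nth_map i) ?size_enum_ord// nth_ord_enum => ->.
by rewrite (nth_map i) ?size_enum_ord// nth_ord_enum tnth_mktuple.
Qed.

Lemma rearrangement_permute q : exists s, decreasing_rearrangement q = permute q s.
Proof.
apply: entries_perm; rewrite /decreasing_rearrangement.
set l := [seq q ord0 j | j : 'I_n]; have sl : size (sort >=%R l) = n.
  by rewrite size_sort size_map size_enum_ord.
suff -> : [seq (\row_(i < n) nth 0 (sort >=%R l) i) ord0 j | j : 'I_n] = sort >=%R l.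
  by rewrite perm_sort.
apply: (@eq_from_nth _ 0); first by rewrite size_map size_enum_ord.
move=> i; rewrite size_map size_enum_ord => iN.
rewrite (nth_map (Ordinal iN)) ?size_enum_ord// (nth_ord_enum _ (Ordinal iN)).
by rewrite mxE.
Qed.

Lemma rearrangement_eq q r :
  perm_eq [seq r ord0 j | j : 'I_n] [seq q ord0 j | j : 'I_n] ->
  decreasing_rearrangement r = decreasing_rearrangement q.
Proof.
move=> rq; apply/rowP => i; rewrite !mxE; congr (nth 0 _ i).
by apply/perm_sortP => // [x y|x y z|x y]; rewrite /=;
  [exact: ge_total|exact: ge_trans|rewrite andbC; exact: le_anti].
Qed.

(** The inverse appears because [perm_mx s], acting on the right, sends entry i to position s i,
    while [permute] reads entry s i at position i. *)
Lemma permute_perm_mx q s : permute q s = q *m perm_mx s^-1.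
Proof. by rewrite -col_permE; apply/rowP => i; rewrite !mxE. Qed.

Lemma permutation_invariant_permute (Q : set 'rV[R]_n) q s :
  permutation_invariant Q -> Q q -> Q (permute q s).
Proof.
by move=> [_ QP] Qq; rewrite permute_perm_mx -(QP s^-1%g); exists q.
Qed.

End Rearrangement.

(** * Preimages under the eigenvalue map *)

(** For fixed x the sets B share the point x, so their union is connected. *)
Lemma connected_by_pairs (T : topologicalType) (A : set T) :
  (forall x y, A x -> A y -> exists B, [/\ connected B, B `<=` A, B x & B y]) ->
  connected A.
Proof.
move=> H; have [->|/set0P[x Ax]] := eqVneq A set0; first exact: connected0.
pose F := [set B : set T | [/\ connected B, B `<=` A & B x]].
have -> : A = \bigcup_(B in F) B.
  apply/seteqP; split=> [y Ay|y [B [_ BA _] By]]; last exact: BA.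
  by have [B [Bc BA Bx By]] := H x y Ax Ay; exists B.
apply: bigcup_connected; first by exists x => B [].
by move=> B [].
Qed.

Section Preimage.
Variables (R : realType) (V : euclideanJordanType R) (n : nat).
Implicit Types (x y : V) (c d : 'I_n -> V) (q r : 'rV[R]_n).

Definition combine c q : V := \sum_(i < n) q ord0 i *: c i.

Lemma combine_weighted_sum c q :
  combine c q = weighted_sum [seq (q ord0 i, c i) | i <- enum 'I_n].
Proof. by rewrite /weighted_sum big_map big_enum. Qed.

Lemma combine_permute c q (s : 'S_n) :
  combine (fun i => c (s i)) (permute q s) = combine c q.
Proof.
rewrite /combine [RHS](reindex_inj (@perm_inj _ s)) /=.
by apply: eq_bigr => i _; rewrite mxE.
Qed.

Lemma frame_permute c (s : 'S_n) :
  jordan_frame c -> jordan_frame (fun i => c (s i)).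
Proof.
move=> [cP co cs]; split=> // [i j ij|].
  by apply: co; apply: contraNneq ij => /perm_inj ->.
by rewrite -cs [RHS](reindex_inj (@perm_inj _ s)).
Qed.

Lemma spectral_exists x : has_rank V n -> exists q, spectral_decomposition x q.
Proof.
move=> [c0 /frame_pfam c0P].
have [s [sP xE]] := spectral_seq (idem_one V) (jmul1 x).
(* The decomposition and the frame given by the rank are both families with sum e. *)
have sn : size s = n.
  have := conn_size (pfam_conn sP c0P).
  by rewrite size_map (size_map c0) size_enum_ord.
exists (\row_i (nth (0, 0) s i).1), (fun i => (nth (0, 0) s i).2); split.
  apply/frame_pfam; move: sP; congr pfam; apply: (@eq_from_nth _ 0).
    by rewrite size_map sn size_map size_enum_ord.
  move=> i; rewrite size_map sn => iN.
  by rewrite (nth_map (0, 0)) ?sn// (nth_map_ord _ (Ordinal iN)).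
rewrite xE (big_nth (0, 0)) sn big_mkord.
by apply: eq_bigr => i _; rewrite mxE.
Qed.

Lemma spectral_unique x q r : spectral_decomposition x q ->
  spectral_decomposition x r ->
  perm_eq [seq q ord0 j | j : 'I_n] [seq r ord0 j | j : 'I_n].
Proof.
move=> [c [/frame_pfam cP xq]] [d [/frame_pfam dP xr]].
have sE (e : 'I_n -> V) (l : 'rV[R]_n) :
    map snd [seq (l ord0 i, e i) | i <- enum 'I_n] = [seq e i | i <- enum 'I_n].
  by rewrite -map_comp.
have H : perm_eq (map fst [seq (q ord0 i, c i) | i <- enum 'I_n])
    (map fst [seq (r ord0 i, d i) | i <- enum 'I_n]).
  apply: (@weighted_sum_perm _ _ jone); rewrite ?sE// -!combine_weighted_sum.
  by rewrite /combine -xq -xr.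
by move: H; rewrite -[X in perm_eq X]map_comp -[X in perm_eq _ X]map_comp.
Qed.

Lemma eigenvalues_spectral x : has_rank V n ->
  spectral_decomposition x (jordan_eigenvalues n x).
Proof.
move=> rk; have [q0 q0P] := spectral_exists x rk.
have := @xgetPex _ 0 [set q | spectral_decomposition x q] (ex_intro _ q0 q0P).
rewrite /jordan_eigenvalues; move: (xget _ _) => q [c [cF xE]].
have [s ->] := rearrangement_permute q.
exists (fun i => c (s i)); split; first exact: frame_permute.
by rewrite -[RHS]/(combine _ _) combine_permute.
Qed.

Lemma eigenvalues_combine c q : jordan_frame c ->
  jordan_eigenvalues n (combine c q) = decreasing_rearrangement q.
Proof.
move=> cF; have cq : spectral_decomposition (combine c q) q by exists c.
have := @xgetPex _ 0 [set r | spectral_decomposition (combine c q) r]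
  (ex_intro _ q cq).
rewrite /jordan_eigenvalues; move: (xget _ _) => r rP.
by apply: rearrangement_eq; exact: spectral_unique rP cq.
Qed.

Lemma combine_cvg (T : topologicalType) (g : 'I_n -> T -> V) (f : T -> 'rV[R]_n) :
  (forall i, continuous (g i)) -> continuous f ->
  continuous (fun t => combine (g^~ t) (f t)).
Proof.
move=> gc fc t; apply: cvg_big_sum => i; apply: cvgZ; last exact: gc.
apply: (@continuous_compose _ _ _ f (fun q => q ord0 i)) => //.
exact: coord_continuous.
Qed.

(** P is Q or its decreasing rearrangement. [frames_move] permits rewriting the target point so that
    its frame becomes reachable as an ordered frame. *)
Variables (A : set V) (P : set 'rV[R]_n).
Hypothesis A_combine : forall x, A x -> exists c q,
  [/\ jordan_frame c, P q & x = combine c q].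
Hypothesis combine_A : forall c q, jordan_frame c -> P q -> A (combine c q).
Hypothesis frames_move : forall c d r, jordan_frame c -> jordan_frame d -> P r ->
  exists d' r', [/\ P r', combine d r = combine d' r' &
    frame_path jone [seq c i | i <- enum 'I_n] [seq d' i | i <- enum 'I_n]].

(** Frame and eigenvalues move simultaneously, along one parameter. *)
Lemma arcwise_connected_lift : arcwise_connected R P -> arcwise_connected R A.
Proof.
move=> Pac x y /A_combine[c [q [cF Pq ->]]] /A_combine[d [r [dF Pr ->]]].
have [d' [r' [Pr' -> /frame_path_frame[g [gc g0 g1 gF]]]]] := frames_move cF dF Pr.
have [f [fc f0 f1 fP]] := Pac _ _ Pq Pr'.
exists (fun t => combine (g^~ t) (f t)); split.
- have gcs i : continuous (g i : subspace `[(0 : R), 1] -> V).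
    exact: continuous_subspaceT.
  exact: (@combine_cvg (subspace `[(0 : R), 1]) g f gcs fc).
- by rewrite f0; apply: eq_bigr => i _; rewrite g0.
- by rewrite f1; apply: eq_bigr => i _; rewrite g1.
- by move=> t t01; apply: combine_A; [exact: gF|exact: fP].
Qed.

(** P may contain no paths, so the path of frames with q fixed is joined to the whole image of P
    under the final frame; the two sets meet at [combine d' q]. *)
Lemma connected_lift : connected P -> connected A.
Proof.
move=> Pc; apply: connected_by_pairs.
move=> x y /A_combine[c [q [cF Pq ->]]] /A_combine[d [r [dF Pr ->]]].
have [d' [r' [Pr' -> /frame_path_frame[g [gc g0 g1 gF]]]]] := frames_move cF dF Pr.
have d'F : jordan_frame d' by have -> : d' = g^~ 1 by apply/funext => i; rewrite g1.
exists ((fun t => combine (g^~ t) q) @` `[0, 1] `|` combine d' @` P).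
have Eg1 : combine (g^~ 1) q = combine d' q by apply: eq_bigr => i _; rewrite g1.
split.
- apply: connectedU.
  + exists (combine d' q); split; last by exists q.
    by exists 1 => //=; rewrite in_itv /= ler01 lexx.
  + apply: connected_continuous_connected; first exact: segment_connected.
    apply: continuous_subspaceT; apply: combine_cvg => //.
    exact: cst_continuous.
  + apply: connected_continuous_connected => //.
    apply: continuous_subspaceT; apply: (combine_cvg (g := fun i _ => d' i)).
      by move=> i; exact: cst_continuous.
    by move=> t; exact: cvg_id.
- move=> _ [[t _ <-]|[q' Pq' <-]]; exact: combine_A.
- left; exists 0; first by rewrite /= in_itv /= lexx ler01.
  by apply: eq_bigr => i _; rewrite g0.
- by right; exists r'.
Qed.

End Preimage.

Theorem theorem3p3 (R : realType) (V : euclideanJordanType R) (n : nat)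
    (rankV : has_rank V n) (Q : set 'rV[R]_n)
    (Qperm : permutation_invariant Q) :
  ((simple_jordan V /\ connected [set decreasing_rearrangement q | q in Q])
     \/ connected Q ->
   connected (@jordan_eigenvalues R V n @^-1` Q))
  /\
  ((simple_jordan V /\
    arcwise_connected R [set decreasing_rearrangement q | q in Q])
     \/ arcwise_connected R Q ->
   arcwise_connected R (@jordan_eigenvalues R V n @^-1` Q)).
Proof.
have QP q s : Q q -> Q (permute q s) by exact: permutation_invariant_permute.
have Qdown q : Q q -> Q (decreasing_rearrangement q).
  by have [s ->] := rearrangement_permute q; exact: QP.
set A := _ @^-1` Q; set D := [set _ | _ in Q].
have A_combine x : A x -> exists c, jordan_frame c /\
    x = combine c (jordan_eigenvalues n x).
  by move=> _; have [c [cF xE]] := eigenvalues_spectral x rankV; exists c.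
have combine_A c q : jordan_frame c -> Q q -> A (combine c q).
  by move=> cF Qq; rewrite /A /= eigenvalues_combine//; exact: Qdown.
have A_D x : A x -> exists c q, [/\ jordan_frame c, D q & x = combine c q].
  move=> Ax; have [c [cF xE]] := A_combine x Ax.
  exists c, (jordan_eigenvalues n x); split=> //.
  (* The eigenvalue vector is its own rearrangement, as seen by computing the eigenvalues of x from
     its decomposition. *)
  exists (jordan_eigenvalues n x) => //.
  by rewrite [in RHS]xE eigenvalues_combine.
have A_Q x : A x -> exists c q, [/\ jordan_frame c, Q q & x = combine c q].
  by move=> Ax; have [c [cF xE]] := A_combine x Ax; exists c, (jordan_eigenvalues n x).
have D_A c q : jordan_frame c -> D q -> A (combine c q).
  by move=> cF [q' Qq' <-]; apply: combine_A => //; exact: Qdown.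
have Q_move (c d : 'I_n -> V) r : jordan_frame c -> jordan_frame d -> Q r ->
  exists d' r', [/\ Q r', combine d r = combine d' r' &
    frame_path jone [seq c i | i <- enum 'I_n] [seq d' i | i <- enum 'I_n]].
  (* The permutation left over by [frames_conn] is absorbed into the eigenvalue vector, which stays
     in Q by invariance. *)
  move=> cF dF Qr; have [s cds] := frames_conn cF dF.
  exists (fun i => d (s i)), (permute r s); split=> //; first exact: QP.
  by rewrite combine_permute.
have D_move (c d : 'I_n -> V) r : simple_jordan V ->
  jordan_frame c -> jordan_frame d -> D r ->
  exists d' r', [/\ D r', combine d r = combine d' r' &
    frame_path jone [seq c i | i <- enum 'I_n] [seq d' i | i <- enum 'I_n]].
  (* Permuting a decreasing vector may leave [D], so r is kept and simplicity supplies a path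
     reaching d in its given order. *)
  by move=> Vs cF dF Dr; exists d, r; split=> //; exact: simple_frames_conn.
split=> -[[Vs Dc]|Qc].
- by apply: (connected_lift A_D D_A) Dc => c d r; exact: D_move.
- exact: (connected_lift A_Q combine_A Q_move) Qc.
- by apply: (arcwise_connected_lift A_D D_A) Dc => c d r; exact: D_move.
- exact: (arcwise_connected_lift A_Q combine_A Q_move) Qc.
Qed.
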